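(* Let $p$ be a prime, let $P$ be a Camina $p$-group, and suppose $P$ acts (by automorphisms) on a nontrivial finite group $Q$ whose order is coprime to $p$, in such a way that $C_P(x) \le P'$ for every $x \in Q \setminus \{1\}$. Then the action of $P$ on $Q$ is Frobenius, i.e. $C_P(x) = 1$ for every $x \in Q \setminus \{1\}$, and $P$ is isomorphic to the quaternion group $Q_8$ of order $8$.
   Context: All groups are finite. $P'$ denotes the derived subgroup of $P$, and $C_P(x) = \{ g \in P : x^g = x\}$ is the centralizer in $P$ of $x \in Q$ under the given action. A group $G$ is a Camina group if $G$ is nonabelian and for every $g \in G \setminus G'$ the conjugacy class of $g$ in $G$ equals the coset $gG'$. A Camina $p$-group is a Camina group that is a $p$-group. *)

(* Defs.v *)
From HB Require Import structures.
From mathcomp Require Import all_boot all_order all_fingroup all_solvable.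
Set Implicit Arguments. Unset Strict Implicit. Unset Printing Implicit Defensive.
Local Open Scope group_scope.

Definition camina (gT : finGroupType) (G : {set gT}) : Prop :=
  ~~ abelian G /\
  forall g, g \in G :\: G^`(1) -> g ^: G = g *: G^`(1).

Definition camina_pgroup (p : nat) (gT : finGroupType) (G : {set gT}) : Prop :=
  p.-group G /\ camina G.

(* Main.v *)
(* If P has odd order, then P has class at most 3.  Writing L_i for the quotient
   of consecutive terms of the lower central series, a vector space over F_p,
   the Camina property says that [x, L_1] = L_2 for every nonzero x in L_1.
   Every functional f on L_2 is then a nondegenerate alternating form on L_1,
   and a Chevalley-Warning count bounds the dimension of a space of such forms,
   giving 2 dim L_2 <= dim L_1.  For a functional f on L_3, the space C_f of all
   a in L_1 with f [L_2, a] = 0 is a maximal isotropic subspace, and commutators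
   of lifts of elements of C_f define a further nondegenerate alternating form
   on C_f.  Counting the pairs x in C_f yields 2 dim L_3 < 3 dim L_2, after which
   linear algebra on the commutator pairings L_3 x L_1 -> L_4 and
   L_2 x L_2 -> L_4 rules out a nonzero L_4.  If p = 2, the squaring map
   L_2 -> L_3 rules out L_3 in the same spirit, so P has class 2.

   Elements of P outside P' act without fixed points on Q.  If p is odd, class
   at most 3 provides x and y, independent modulo P', with a central commutator
   of order dividing p.  On a minimal <x, y>-invariant subgroup M of Q the
   centre acts as a cyclic group, so some w outside P' has w^p acting trivially
   on M; then w and the central elements of order p generate noncyclic groups
   acting fixed-point-freely, which is impossible.  If p = 2, the same argument
   applied to P shows that no square of an element outside P' is trivial on M,
   which forces |P'| = 2 and |P| = 8. *)

Require Import Defs.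
From HB Require Import structures.
From mathcomp Require Import all_boot all_order all_fingroup all_solvable.
From mathcomp Require Import all_algebra all_field all_character.
From mathcomp Require Import zify.
Set Implicit Arguments. Unset Strict Implicit. Unset Printing Implicit Defensive.
Import GRing.Theory.
Local Open Scope ring_scope.

(** * Additive maps and subspaces over a prime field *)

Section AdditiveFp.

Variable p : nat.
Local Notation F := 'F_p.

Definition additive2 (U V W : zmodType) (b : U -> V -> W) : Prop :=
  (forall v, {morph b^~ v : x y / x + y}) /\ (forall u, {morph b u : x y / x + y}).

Lemma additive_0 (U V : zmodType) (g : U -> V) :
  {morph g : x y / x + y} -> g 0 = 0.
Proof. by move=> gD; apply: (addIr (g 0)); rewrite -gD !add0r. Qed.

Lemma additive_N (U V : zmodType) (g : U -> V) :
  {morph g : x y / x + y} -> {morph g : x / - x}.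
Proof.
by move=> gD x; apply: (addIr (g x)); rewrite -gD !addNr additive_0.
Qed.

(** Every scalar of ['F_p] is the image of a natural number, so additivity already gives linearity.
    For this reason maps and pairings are only assumed additive. *)
Lemma additive_scale (U V : lmodType F) (g : U -> V) (a : F) :
  {morph g : x y / x + y} -> {morph g : x / a *: x}.
Proof.
move=> gD x; rewrite -(natr_Zp a) !scaler_nat.
by elim: (nat_of_ord a) => [|n IHn]; rewrite ?mulr0n ?additive_0 // !mulrS gD IHn.
Qed.

Lemma additive_scaleF (U : lmodType F) (g : U -> F) (a : F) u :
  {morph g : x y / x + y} -> g (a *: u) = a * g u.
Proof. by move=> gD; apply: (additive_scale (V := F^o)). Qed.

Lemma additive_sum (U V : zmodType) (g : U -> V) (I : Type) (r : seq I) (P : pred I) (E : I -> U) :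
  {morph g : x y / x + y} -> g (\sum_(i <- r | P i) E i) = \sum_(i <- r | P i) g (E i).
Proof. by move=> gD; apply: (big_morph g gD); apply: additive_0. Qed.

Section Additive2.
Variables (U V W : zmodType) (b : U -> V -> W).
Hypothesis bA : additive2 b.

Lemma additive2Dl u u' v : b (u + u') v = b u v + b u' v. Proof. exact: (bA.1 v). Qed.
Lemma additive2Dr u v v' : b u (v + v') = b u v + b u v'. Proof. exact: (bA.2 u). Qed.
Lemma additive2_0l v : b 0 v = 0. Proof. exact: (additive_0 (bA.1 v)). Qed.
Lemma additive2_0r u : b u 0 = 0. Proof. exact: (additive_0 (bA.2 u)). Qed.
Lemma additive2Nl u v : b (- u) v = - b u v. Proof. exact: (additive_N (bA.1 v)). Qed.
Lemma additive2Nr u v : b u (- v) = - b u v. Proof. exact: (additive_N (bA.2 u)). Qed.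
End Additive2.

(* Spanned by the vectors satisfying P, hence equal to their set only if P is closed
   under addition. *)
Definition subspace_of n (P : pred 'rV[F]_n) : {vspace 'rV[F]_n} :=
  <<[seq u <- enum 'rV[F]_n | P u]>>%VS.

Lemma mem_subspace_of n (P : pred 'rV[F]_n) : P 0 -> (forall u v, P u -> P v -> P (u + v)) ->
  forall u, (u \in subspace_of P) = P u.
Proof.
move=> P0 PD u; apply/idP/idP => [|Pu]; last first.
  by apply: memv_span; rewrite mem_filter Pu mem_enum.
have PZ (a : F) v : P v -> P (a *: v).
  move=> Pv; rewrite -(natr_Zp a) scaler_nat.
  by elim: (nat_of_ord a) => [|k IHk]; rewrite ?mulr0n // mulrS PD.
rewrite /subspace_of; set s := filter _ _.
have sP i : P s`_i.
  have [lti|lei] := ltnP i (size s); last by rewrite nth_default.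
  by have := mem_nth 0 lti; rewrite mem_filter => /andP[].
move/(coord_span (X := in_tuple s)) ->.
by elim/big_ind: _ => // i _; apply: PZ.
Qed.

(** The values of [g] on the standard basis form a matrix, so [g] is linear. Kernel and image are
    given by membership, which suits maps that are bare additive functions. *)
Lemma rank_nullity n m (A : {vspace 'rV[F]_n}) (g : 'rV[F]_n -> 'rV[F]_m) :
  {morph g : x y / x + y} ->
  exists (K : {vspace 'rV[F]_n}) (I : {vspace 'rV[F]_m}),
    [/\ forall u, (u \in K) = (u \in A) && (g u == 0),
        forall u, u \in A -> g u \in I,
        forall v, v \in I -> exists2 u, u \in A & g u = v &
        (\dim K + \dim I = \dim A)%N].
Proof.
move=> gD; pose M := \matrix_i g (delta_mx 0 i).
have gM u : g u = linfun (mulmxr M) u.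
  rewrite lfunE /= mulmx_sum_row {1}[u]row_sum_delta additive_sum //.
  by apply: eq_bigr => i _; rewrite additive_scale // rowK.
set f := linfun _ in gM.
exists (A :&: lker f)%VS, (f @: A)%VS; split; last exact: limg_ker_dim.
- by move=> u; rewrite memv_cap memv_ker gM.
- by move=> u Au; rewrite gM memv_img.
- by move=> v /memv_imgP[u Au ->]; exists u; rewrite ?gM.
Qed.

(* Restricting b u to a complement of B is a map on A with kernel inside R. *)
Lemma perp_dim n m (b : 'rV[F]_n -> 'rV[F]_m -> F) (A R : {vspace 'rV[F]_n}) (B : {vspace 'rV[F]_m}) :
  additive2 b -> {in A & B, forall u v, b u v = 0} ->
  (forall u, (forall v, b u v = 0) -> u \in R) ->
  (\dim A + \dim B <= m + \dim R)%N.
Proof.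
move=> bA bAB bR; set X := vbasis B^C.
pose g u : 'rV[F]_(\dim B^C) := \row_i b u X`_i.
have gD : {morph g : x y / x + y}.
  by move=> x y; apply/rowP => i; rewrite !mxE additive2Dl.
have [K [I [KE _ _ <-]]] := rank_nullity A gD.
have sKR : (K <= R)%VS.
  apply/subvP => u; rewrite KE => /andP[Au /eqP gu0]; apply: bR => v.
  have /memv_addP[v1 Bv1 [v2 Cv2 ->]] : v \in (B + B^C)%VS by rewrite addv_complf memvf.
  rewrite (additive2Dr bA) bAB // add0r (coord_vbasis Cv2) (additive_sum _ _ _ (bA.2 u)).
  rewrite big1 // => i _; rewrite (additive_scaleF _ _ (bA.2 u)).
  by move/rowP: gu0 => /(_ i); rewrite !mxE => ->; rewrite mulr0.
have dI : (\dim I <= \dim B^C)%N.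
  by rewrite (leq_trans (dimvS (subvf _))) // dimvf /dim /= mul1n.
have dB : (\dim B^C + \dim B = m)%N.
  rewrite dimv_compl dimvf /dim /= mul1n subnK // (leq_trans (dimvS (subvf _))) //.
  by rewrite dimvf /dim /= mul1n.
by have := dimvS sKR; lia.
Qed.

End AdditiveFp.

(** * Spaces of nonsingular alternating forms *)

Section Warning.

Variable p : nat.
Hypothesis p_pr : prime p.
Local Notation F := 'F_p.

Lemma natr_p_Fp : p%:R = 0 :> F.
Proof. exact: pcharf0 (pchar_Fp p_pr). Qed.

(** For a positive exponent [e], the polynomial [X^e - 1] has at most [e < p - 1] roots, so some
    nonzero [g] has [g ^+ e != 1]; multiplication by [g] permutes the field and scales the sum by
    [g ^+ e]. For exponent 0 all [p] terms are 1. *)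
Lemma sum_exp_Fp e : (e < p.-1)%N -> \sum_(t : F) t ^+ e = 0.
Proof.
case: e => [|e] lt_e.
  by rewrite (eq_bigr (fun=> 1)) // sumr_const card_Fp // natr_p_Fp.
have [g g0 ge1] : exists2 g : F, g != 0 & g ^+ e.+1 != 1.
  apply/exists_inP; apply/exists_inPn => /= all1.
  have := @max_poly_roots _ ('X^(e.+1) - 1%:P) [seq t <- enum F | t != 0 :> F].
  rewrite -size_poly_eq0 size_XnsubC // => /(_ isT).
  rewrite filter_uniq ?enum_uniq // => H.
  have /H/(_ isT) : all (root ('X^(e.+1) - 1%:P)) [seq t <- enum F | t != 0 :> F].
    apply/allP => t; rewrite mem_filter => /andP[t0 _].
    by rewrite /root !hornerE subr_eq0; have := all1 t t0; rewrite negbK.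
  have -> : size [seq t <- enum F | t != 0 :> F] = p.-1.
    have := cardC1 (0 : F); rewrite card_Fp // => <-.
    by rewrite cardE /enum_mem -filter_predI; congr size; apply: eq_filter => t; rewrite !inE andbT.
  by rewrite ltnS leqNgt lt_e.
have : (1 - g ^+ e.+1) * (\sum_(t : F) t ^+ e.+1) = 0.
  rewrite mulrBl mul1r; apply/eqP; rewrite subr_eq0; apply/eqP.
  rewrite [LHS](reindex_inj (mulfI g0)) mulr_sumr; apply: eq_bigr => t _.
  by rewrite exprMn.
by move/eqP; rewrite mulf_eq0 subr_eq0 eq_sym (negbTE ge1) => /eqP.
Qed.

Lemma sum_monomial_Fp m (e : 'I_m -> nat) k : (e k < p.-1)%N ->
  \sum_(c : 'rV[F]_m) \prod_i c 0 i ^+ e i = 0.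
Proof.
move=> lt_ek.
rewrite (reindex (fun f : {ffun 'I_m -> F} => \row_i f i)); last first.
  exists (fun c : 'rV[F]_m => [ffun i => c 0 i]) => [f _ | c _].
    by apply/ffunP => i; rewrite ffunE mxE.
  by apply/rowP => i; rewrite mxE ffunE.
transitivity (\sum_(f : {ffun 'I_m -> F}) \prod_i f i ^+ e i).
  by apply: eq_bigr => f _; apply: eq_bigr => i _; rewrite mxE.
rewrite -(bigA_distr_bigA (fun i t => t ^+ e i)).
by apply/eqP/prodf_eq0; exists k => //; rewrite sum_exp_Fp.
Qed.

(** The expansion consists of monomials of degree [#|I|] in [m] variables, so in each some variable
    has exponent below [p - 1]. This is the counting step of the Chevalley-Warning theorem. *)
Lemma sum_prod_linear_Fp (I : finType) m (a : I -> 'I_m -> F) :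
  (#|I| < m * p.-1)%N ->
  \sum_(c : 'rV[F]_m) \prod_(i : I) (\sum_k c 0 k * a i k) = 0.
Proof.
move=> ltI; under eq_bigr do rewrite bigA_distr_bigA /=.
rewrite exchange_big big1 //= => f _.
under eq_bigr do rewrite big_split /=.
rewrite -mulr_suml; set e := fun k => #|[pred i | f i == k]|.
have -> : \sum_(c : 'rV[F]_m) \prod_i c 0 (f i) = \sum_(c : 'rV[F]_m) \prod_k c 0 k ^+ e k.
  apply: eq_bigr => c _; rewrite (partition_big f predT) //=.
  apply: eq_bigr => k _; rewrite (eq_bigr (fun=> c 0 k)) => [|i /eqP-> //].
  by rewrite prodr_const.
have [k lt_ek] : exists k, (e k < p.-1)%N.
  apply/existsP; apply: contraLR ltI => /existsPn e_ge; rewrite -leqNgt.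
  have -> : #|I| = (\sum_k e k)%N.
    rewrite -sum1_card (partition_big f predT) //=.
    by apply: eq_bigr => k _; rewrite sum1_card.
  rewrite -[m in (m * _)%N]card_ord -sum_nat_const.
  by apply: leq_sum => k _; rewrite leqNgt.
by rewrite (sum_monomial_Fp lt_ek) mul0r.
Qed.

End Warning.

Section Skew.

Variable K : fieldType.
Hypothesis two_neq0 : 2%:R != 0 :> K.

Lemma skew_diag n (A : 'M[K]_n) i : A^T = - A -> A i i = 0.
Proof.
move/matrixP/(_ i i); rewrite !mxE => /eqP; rewrite -addr_eq0 -mulr2n -mulr_natl.
by rewrite mulf_eq0 (negbTE two_neq0) => /eqP.
Qed.

Lemma det_skew2 (A : 'M[K]_2) : A^T = - A -> \det A = A 0 1 ^+ 2.
Proof.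
move=> tA; rewrite (expand_det_row _ 0) !big_ord_recl big_ord0 (skew_diag _ tA).
rewrite mul0r add0r addr0 /cofactor /= det_mx11 !mxE /= mulN1r.
have -> : lift 0 0 = 1 :> 'I_2 by apply: val_inj.
have -> : lift 1 0 = 0 :> 'I_2 by apply: val_inj.
by move/matrixP/(_ 0 1): tA; rewrite !mxE => ->; rewrite opprK expr2.
Qed.

(** Existence of the Pfaffian, by induction in steps of two: a nonzero entry of the first row is
    moved to position (0, 1) by permuting rows and columns simultaneously, and the Schur complement
    of the leading 2 x 2 block is again skew. *)
Lemma det_skew_square n (A : 'M[K]_n) : A^T = - A -> exists d, \det A = d ^+ 2.
Proof.
elim/ltn_ind: n A => -[|n] IHn A tA; first by exists 1; rewrite det_mx00 expr1n.
have [A0|[j A0j]] : (forall j, A ord0 j = 0) \/ exists j, A ord0 j != 0.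
  have [/forallP A0|/forallPn[j Aj]] := boolP [forall j, A ord0 j == 0].
    by left=> j; apply/eqP.
  by right; exists j.
  exists 0; rewrite (expand_det_row A ord0) big1 ?expr0n // => j _.
  by rewrite A0 mul0r.
case: n IHn A tA j A0j => [|n] IHn A tA j A0j.
  by case/eqP: A0j; rewrite (ord1 j); apply: skew_diag.
pose s := tperm (lift ord0 ord0) j; pose S : 'M[K]_(2 + n) := perm_mx s.
pose B : 'M[K]_(2 + n) := S *m A *m S^T.
have tB : B^T = - B by rewrite !trmx_mul trmxK tA mulmxA mulmxN mulNmx.
have dB : \det B = \det A.
  rewrite !det_mulmx det_tr mulrAC -expr2 det_perm -signr_odd.
  by case: (odd _); rewrite ?sqrrN expr1n mul1r.
have j0 : j != ord0 by apply: contraNneq A0j => ->; rewrite (skew_diag _ tA).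
have B01 : B ord0 (lift ord0 ord0) != 0.
  rewrite /B /S -row_permE tr_perm_mx -col_permE !mxE.
  by rewrite tpermL tpermD // eq_sym.
clearbody B; set Bul := ulsubmx B; set Bur := ursubmx B; set Bdl := dlsubmx B; set Bdr := drsubmx B.
have BE : B = block_mx Bul Bur Bdl Bdr by rewrite submxK.
have [tul tur tdr] : [/\ Bul^T = - Bul, Bdl = - Bur^T & Bdr^T = - Bdr].
  move: tB; rewrite BE tr_block_mx opp_block_mx => /eq_block_mx[-> _ -> ->].
  by rewrite opprK.
pose a := Bul 0 1.
have a0 : a != 0.
  rewrite /a /Bul !mxE; set i := lshift _ _; set k := lshift _ _.
  have -> : i = ord0 by apply: val_inj.
  by have -> : k = lift ord0 ord0 by apply: val_inj.
have ulE : \det Bul = a ^+ 2 by apply: det_skew2.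
have ul_unit : Bul \in unitmx.
  rewrite unitmxE ulE unitfE; exact: expf_neq0 a0.
pose C := Bdr + Bur^T *m invmx Bul *m Bur.
have tC : C^T = - C.
  rewrite /C linearD /= !trmx_mul trmxK trmx_inv tul tdr opprD; congr (_ + _).
  have -> : invmx (- Bul) = - invmx Bul.
    by rewrite -scaleN1r invmxZ ?invrN1 scaleN1r // -tul unitmx_tr.
  by rewrite mulNmx mulmxN mulmxA.
have {}BE : B = block_mx 1%:M 0 (Bdl *m invmx Bul) 1%:M *m block_mx Bul Bur 0 C.
  rewrite mulmx_block !mul1mx !mul0mx !addr0 mulmxKV // BE tur /C.
  by rewrite mulNmx mulNmx addrCA addNr addr0.
have [d dC] := IHn n (ltnW (leqnn _)) C tC.
exists (a * d); rewrite -dB BE det_mulmx det_lblock det_ublock !det1 !mul1r ulE dC.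
by rewrite exprMn.
Qed.

End Skew.

(** The points moved by [f] fall into pairs with equal values, and twice a value is 0. The
    enumeration order selects one point of each pair. *)
Lemma sum_involution_pchar2 (R : nzRingType) (T : finType) (f : T -> T) (G : T -> R) :
  2%N \in [pchar R] -> involutive f -> (forall x, G (f x) = G x) ->
  \sum_(x | f x != x) G x = 0.
Proof.
move=> char2 fK Gf.
rewrite (bigID (fun x => (enum_rank x < enum_rank (f x))%N)) /=.
rewrite [X in _ + X](reindex_inj (inv_inj fK)) /=.
rewrite [X in _ + X](eq_big (fun x => (f x != x) && (enum_rank x < enum_rank (f x))%N) G) //.
  by rewrite -mulr2n -mulr_natr (pcharf0 char2) mulr0.
move=> x; rewrite fK eq_sym; apply: andb_id2l => nfx; rewrite -leqNgt ltn_neqAle.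
by rewrite (inj_eq val_inj) (inj_eq enum_rank_inj) eq_sym nfx.
Qed.

(** These permutations are the perfect matchings of the index set; the Pfaffian is a sum over
    them. *)
Definition fpf_involution N (s : 'S_N) := (s^-1%g == s) && [forall i, s i != i].

Lemma fpf_involution_card N (s : 'S_N) : fpf_involution s ->
  (2 * #|[pred i : 'I_N | (i < s i)%N]|)%N = N.
Proof.
case/andP=> /eqP sV /forallP s_fpf; have sK i : s (s i) = i by rewrite -{1}sV permK.
rewrite -[RHS]card_ord -[RHS](cardC [pred i : 'I_N | (i < s i)%N]) mul2n -addnn.
congr (_ + _)%N; rewrite -(card_image (@perm_inj _ s)); apply: eq_card => i.
rewrite !inE -leqNgt leq_eqVlt (inj_eq val_inj) (negbTE (s_fpf i)) /=.
apply/imageP/idP => [[j]|lt_si]; first by rewrite inE => ltj ->; rewrite sK.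
by exists (s i); rewrite ?sK // inE sK.
Qed.

(* The Leibniz terms of s and s^-1 are equal and cancel when s != s^-1, and an
   involution contributes each entry twice, where x ^+ 2 = x in F_2. *)
Lemma det_alternating_F2 N (A : 'M['F_2]_N) : A^T = - A -> (forall i, A i i = 0) ->
  \det A = \sum_(s : 'S_N | fpf_involution s) \prod_(i : 'I_N | (i < s i)%N) A i (s i).
Proof.
move=> tA dA.
have char2 : 2%N \in [pchar 'F_2] by apply: pchar_Fp.
have sA i j : A j i = A i j by move/matrixP/(_ i j): tA; rewrite !mxE oppr_pchar2.
have -> : \det A = \sum_(s : 'S_N) \prod_i A i (s i).
  by apply: eq_bigr => s _; rewrite oppr_pchar2 // expr1n mul1r.
rewrite (bigID (fun s : 'S_N => s^-1%g != s)) /= (sum_involution_pchar2 char2) ?add0r.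
- rewrite (bigID (fun s : 'S_N => [forall i, s i != i])) /= [X in _ + X]big1 ?addr0.
    apply: eq_big => [s|s]; first by rewrite negbK.
    rewrite negbK => /andP[/eqP sV /forallP s_fpf].
    have sK i : s (s i) = i by rewrite -{1}sV permK.
    rewrite (bigID (fun i : 'I_N => i < s i)%N) /= [X in _ * X](reindex_inj (@perm_inj _ s)) /=.
    rewrite [X in _ * X](eq_big (fun i : 'I_N => i < s i)%N (fun i => A i (s i))).
    + rewrite -expr2 -[RHS]expf_card card_Fp //.
    + by move=> i; rewrite sK -leqNgt ltn_neqAle (inj_eq val_inj) eq_sym s_fpf.
    + by move=> i _; rewrite sK sA.
  move=> s /andP[_ /forallPn[i]]; rewrite negbK => /eqP si.
  by rewrite (bigD1 i) //= si dA mul0r.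
- exact: invgK.
- move=> s; rewrite (reindex_inj (@perm_inj _ s)); apply: eq_bigr => i _.
  by rewrite permK sA.
Qed.

Lemma alternating_unitmx_F2 N (A : 'M['F_2]_N) : A^T = - A -> (forall i, A i i = 0) ->
  A \in unitmx -> ~~ odd N.
Proof.
move=> tA dA; rewrite unitmxE unitfE det_alternating_F2 //; apply: contraNN => oddN.
by rewrite big_pred0 // => s; apply/negP => /fpf_involution_card/(congr1 odd); rewrite oddM oddN.
Qed.

(* On the span of the B k, the function \det ^+ (p.-1)./2, or \det if p = 2, is the
   indicator of the nonzero elements, so it sums to -1; it is a sum of products of
   N * p.-1 / 2 linear forms, so it would sum to 0 if N < 2 * m. *)
Lemma alternating_mx_space p N m (B : 'I_m -> 'M['F_p]_N) : prime p -> (0 < N)%N ->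
  (forall k, (B k)^T = - B k) -> (forall k i, B k i i = 0) ->
  (forall c : 'rV['F_p]_m, c != 0 -> \sum_k c 0 k *: B k \in unitmx) ->
  (2 * m <= N)%N.
Proof.
move=> p_pr N0 tB dB uB; rewrite leqNgt; apply/negP => ltN.
pose M (c : 'rV['F_p]_m) := \sum_k c 0 k *: B k.
have tM c : (M c)^T = - M c.
  rewrite /M linear_sum -sumrN; apply: eq_bigr => k _.
  by rewrite linearZ /= tB scalerN.
have ME c i j : M c i j = \sum_k c 0 k * B k i j.
  by rewrite /M summxE; apply: eq_bigr => k _; rewrite mxE.
have dM c i : M c i i = 0 by rewrite ME big1 // => k _; rewrite dB mulr0.
have M0 : \det (M 0) = 0.
  rewrite (expand_det_row _ (Ordinal N0)) big1 // => j _.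
  by rewrite ME big1 ?mul0r // => k _; rewrite mxE mul0r.
have m0 : (0 < m)%N by lia.
(* There are p^m - 1 nonzero vectors [c], and this number is -1 modulo [p] because [m] is
   positive. *)
have sum1 (G : 'rV['F_p]_m -> 'F_p) :
    G 0 = 0 -> (forall c, c != 0 -> G c = 1) -> \sum_c G c = -1.
  move=> G0 G1; rewrite (bigD1 0) //= G0 add0r (eq_bigr (fun=> 1)) //.
  rewrite sumr_const cardC1 card_mx card_Fp // mul1n.
  apply: (addIr 1); rewrite addNr -mulrSr prednK ?expn_gt0 ?prime_gt0 //.
  by rewrite natrX natr_p_Fp // expr0n; case: (m) m0.
have [p2|p_neq2] := eqVneq p 2%N.
  subst p; have S1 : \sum_c \det (M c) = -1.
    apply: sum1 => // c c0; have := uB c c0; rewrite unitmxE unitfE -/(M c).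
    by case: (\det (M c)) => -[|[|?]] // ? _; apply: val_inj.
  suff S0 : \sum_c \det (M c) = 0.
    by move/eqP: S1; rewrite S0 eq_sym oppr_eq0 oner_eq0.
  under eq_bigr do rewrite det_alternating_F2 //.
  rewrite exchange_big big1 //= => s sP.
  have cardI := fpf_involution_card sP.
  pose J := [pred i : 'I_N | (i < s i)%N].
  rewrite (eq_bigr (fun c : 'rV_m => \prod_(i : {i : 'I_N | i \in J})
    (\sum_k c 0 k * B k (val i) (s (val i))))) => [|c _].
    apply: (sum_prod_linear_Fp p_pr (fun i k => B k (val i) (s (val i)))).
    by rewrite card_sig muln1 -(ltn_pmul2l (isT : 0 < 2)%N) cardI.
  rewrite -(big_sub J (fun i => \sum_k c 0 k * B k i (s i))).
  by apply: eq_bigr => i _; rewrite ME.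
have p_odd : odd p by case/even_prime: p_pr p_neq2 => // ->.
have two0 : 2%:R != 0 :> 'F_p.
  by rewrite -(dvdn_pcharf (pchar_Fp p_pr)) gtnNdvd // ltn_neqAle eq_sym p_neq2 prime_gt1.
set h := p.-1./2; have hE : (2 * h)%N = p.-1.
  by rewrite /h; have := odd_double_half p; rewrite p_odd; lia.
have S1 : \sum_c \det (M c) ^+ h = -1.
  apply: (sum1 (fun c => \det (M c) ^+ h)) => [|c c0].
    by rewrite M0 expr0n; have := prime_gt1 p_pr; case: (h) hE => //; lia.
  (* The determinant is a square [d ^+ 2], so its power [h] is [d ^+ p.-1], which is 1 by Fermat. *)
  have [d dE] := det_skew_square two0 (tM c).
  rewrite dE -exprM hE.
  have d0 : d != 0.
    by have := uB c c0; rewrite unitmxE unitfE -/(M c) dE expf_eq0.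
  apply: (mulIf d0); rewrite -exprSr prednK ?prime_gt0 // mul1r.
  by rewrite -[RHS]expf_card card_Fp.
suff S0 : \sum_c \det (M c) ^+ h = 0.
  by move/eqP: S1; rewrite S0 eq_sym oppr_eq0 oner_eq0.
(* In the power [h] of the Leibniz formula, [f] chooses one permutation per factor; each summand is
   a sign times a product of [h * N] linear forms in [c]. *)
have detE c : \det (M c) ^+ h =
    \sum_(f : {ffun 'I_h -> 'S_N}) (\prod_i (-1) ^+ f i) *
      \prod_(ij : 'I_h * 'I_N) (\sum_k c 0 k * B k ij.2 (f ij.1 ij.2)).
  rewrite -[h in LHS]card_ord -prodr_const bigA_distr_bigA /=.
  apply: eq_bigr => f _; rewrite big_split /=; congr (_ * _).
  rewrite -(pair_bigA _ (fun i j => \sum_k c 0 k * B k j (f i j))) /=.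
  by apply: eq_bigr => i _; apply: eq_bigr => j _; rewrite ME.
under eq_bigr do rewrite detE.
rewrite exchange_big big1 //= => f _; rewrite -mulr_sumr.
rewrite (sum_prod_linear_Fp p_pr (fun ij k => B k ij.2 (f ij.1 ij.2))) ?mulr0 //.
have h0 : (0 < h)%N by have := prime_gt1 p_pr; lia.
by rewrite card_prod !card_ord -hE (mulnC h) (mulnCA m) mulnA ltn_pmul2r.
Qed.

(** * Alternating forms on subspaces *)

Section Forms.

Variable p : nat.
Local Notation F := 'F_p.

Lemma additive_on_sum n (A : {vspace 'rV[F]_n}) (g : 'rV[F]_n -> F) :
  {in A &, {morph g : x y / x + y}} ->
  forall (I : finType) (c : I -> F) (X : I -> 'rV[F]_n), (forall i, X i \in A) ->
  g (\sum_i c i *: X i) = \sum_i c i * g (X i).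
Proof.
move=> gD I c X AX.
have g0 : g 0 = 0 by apply: (addIr (g 0)); rewrite -gD ?mem0v // !add0r.
have gZ a u : u \in A -> g (a *: u) = a * g u.
  move=> Au; rewrite -(natr_Zp a) scaler_nat mulr_natl.
  elim: (nat_of_ord a) => [|k IHk]; rewrite ?mulr0n // !mulrS gD ?IHk //.
  by rewrite -scaler_nat memvZ.
suff [_ //] : (\sum_i c i *: X i \in A) /\ g (\sum_i c i *: X i) = \sum_i c i * g (X i).
elim/big_ind2: _ => [|u a v b [Au <-] [Av <-] | i _]; first by rewrite mem0v.
  by rewrite memvD ?gD.
by rewrite memvZ ?gZ.
Qed.

(** The conditions are relative to [A] because commutators of lifts define a form only on certain
    subspaces. *)
Definition alternating_on n (A : {vspace 'rV[F]_n}) (e : 'rV[F]_n -> 'rV[F]_n -> F) : Prop :=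
  [/\ {in A, forall v, {in A &, {morph e^~ v : x y / x + y}}},
      {in A, forall u, {in A &, {morph e u : x y / x + y}}} &
      {in A, forall u, e u u = 0}].

Definition nondegenerate_on n (A : {vspace 'rV[F]_n}) (e : 'rV[F]_n -> 'rV[F]_n -> F) : Prop :=
  {in A, forall u, u != 0 -> exists2 v, v \in A & e u v != 0}.

Lemma alternatingN n (A : {vspace 'rV[F]_n}) e : alternating_on A e ->
  {in A &, forall u v, e v u = - e u v}.
Proof.
case=> eDl eDr e0 u v Au Av; apply/eqP; rewrite -addr_eq0 addrC.
by have := e0 _ (memvD Au Av); rewrite eDl ?eDr ?memvD // !e0 // add0r addr0 => ->.
Qed.

Definition gram n (A : {vspace 'rV[F]_n}) (e : 'rV[F]_n -> 'rV[F]_n -> F) : 'M[F]_(\dim A) :=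
  \matrix_(i, j) e (vbasis A)`_i (vbasis A)`_j.

Lemma gram_alternating n (A : {vspace 'rV[F]_n}) e : alternating_on A e ->
  (gram A e)^T = - gram A e /\ forall i, gram A e i i = 0.
Proof.
move=> eA; have XA i : (vbasis A)`_i \in A.
  have [lti|lei] := ltnP i (size (vbasis A)); last by rewrite nth_default // mem0v.
  by rewrite (vbasis_mem (mem_nth _ _)).
split=> [|i]; last by rewrite mxE; case: eA => _ _ ->.
by apply/matrixP => i j; rewrite !mxE (alternatingN eA).
Qed.

(** A row vector in the kernel of the Gram matrix is the coordinate vector of an element of [A]
    orthogonal to all of [A]. *)
Lemma gram_unit n (A : {vspace 'rV[F]_n}) e : alternating_on A e -> nondegenerate_on A e ->
  gram A e \in unitmx.
Proof.
case=> eDl eDr _ nd; have XA (i : 'I_(\dim A)) : (vbasis A)`_i \in A.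
  by apply: vbasis_mem; rewrite mem_nth // size_tuple.
rewrite -row_free_unit -kermx_eq0; apply/rowV0P => c /sub_kermxP cG0.
apply/eqP/contraT => c0; set u := \sum_i c 0 i *: (vbasis A)`_i.
have Au : u \in A by apply: memv_suml => i _; rewrite memvZ.
have u0 : u != 0.
  apply: contraNneq c0 => u0; apply/eqP/rowP => i; rewrite mxE.
  by have /freeP/(_ (c 0))/(_ u0 i) := basis_free (vbasisP A).
have [v Av] := nd u Au u0; case/eqP; rewrite (coord_vbasis Av).
rewrite (additive_on_sum (eDr u Au)) // big1 // => j _.
rewrite (additive_on_sum (eDl _ (XA j))) //.
by move/rowP/(_ j): cG0; rewrite !mxE; under eq_bigr do rewrite mxE; move=> ->; rewrite mulr0.
Qed.

(** Gram matrices in a fixed basis of [A] turn a basis of [Phi] into matrices to which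
    [alternating_mx_space] applies. *)
Lemma alternating_space_dim n m (A : {vspace 'rV[F]_n}) (Phi : {vspace 'rV[F]_m})
    (e : 'rV[F]_m -> 'rV[F]_n -> 'rV[F]_n -> F) :
  prime p -> A != 0%VS ->
  {in A &, forall u v, {in Phi &, {morph (fun f => e f u v) : x y / x + y}}} ->
  {in Phi, forall f, alternating_on A (e f)} ->
  {in Phi, forall f, f != 0 -> nondegenerate_on A (e f)} ->
  (2 * \dim Phi <= \dim A)%N.
Proof.
move=> p_pr A0 eDf eA nd.
have XA (i : 'I_(\dim A)) : (vbasis A)`_i \in A.
  by apply: vbasis_mem; rewrite mem_nth // size_tuple.
have XPhi (i : 'I_(\dim Phi)) : (vbasis Phi)`_i \in Phi.
  by apply: vbasis_mem; rewrite mem_nth // size_tuple.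
apply: (@alternating_mx_space p _ _ (fun k => gram A (e (vbasis Phi)`_k))) => //.
- by rewrite lt0n dimv_eq0.
- by move=> k; case: (gram_alternating (eA _ (XPhi k))).
- by move=> k; case: (gram_alternating (eA _ (XPhi k))).
move=> c c0; set f := \sum_i c 0 i *: (vbasis Phi)`_i.
have Phif : f \in Phi by apply: memv_suml => i _; rewrite memvZ.
have f0 : f != 0.
  apply: contraNneq c0 => f0; apply/eqP/rowP => i; rewrite mxE.
  by have /freeP/(_ (c 0))/(_ f0 i) := basis_free (vbasisP Phi).
have := gram_unit (eA f Phif) (nd f Phif f0); congr (_ \in unitmx).
apply/matrixP => i j; rewrite mxE summxE (additive_on_sum (eDf _ _ (XA i) (XA j))) //.
by apply: eq_bigr => k _; rewrite !mxE.
Qed.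

End Forms.

Lemma alternating_even_F2 n (A : {vspace 'rV['F_2]_n}) e :
  alternating_on A e -> nondegenerate_on A e -> ~~ odd (\dim A).
Proof.
move=> eA nd; have [tG dG] := gram_alternating eA.
exact: alternating_unitmx_F2 tG dG (gram_unit eA nd).
Qed.

Section Dot.
Variables (p n : nat).
Local Notation F := 'F_p.

(** Identifies a row space with its dual, so that families of functionals are subspaces of row
    vectors and have a dimension. *)
Definition dot (z f : 'rV[F]_n) : F := \sum_i z 0 i * f 0 i.

Lemma dotA : additive2 dot.
Proof.
by split=> [f x y|z x y]; rewrite /dot -big_split; apply: eq_bigr => i _;
  rewrite mxE ?mulrDl ?mulrDr.
Qed.

Lemma dot_delta f i : dot (delta_mx 0 i) f = f 0 i.
Proof.
rewrite /dot (bigD1 i) //= mxE !eqxx mul1r big1 ?addr0 // => j /negbTE ji.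
by rewrite mxE ji mul0r.
Qed.

Lemma dot_neq0 f : f != 0 -> exists z, dot z f != 0.
Proof.
move=> f0; have [i fi] : exists i, f 0 i != 0.
  apply/existsP; apply: contraNT f0 => /existsPn f0; apply/eqP/rowP => i.
  by rewrite mxE; apply/eqP; rewrite -[_ == _]negbK.
by exists (delta_mx 0 i); rewrite dot_delta.
Qed.

End Dot.

Lemma row_dim0 p n (u : 'rV['F_p]_n) : n = 0%N -> u = 0.
Proof. by move=> n0; apply/rowP => -[i lti]; exfalso; rewrite n0 in lti. Qed.

(** * The first three quotients of the lower central series *)

Section CaminaLie.

Variables (p n1 n2 n3 : nat).
Local Notation F := 'F_p.
Local Notation L1 := 'rV[F]_n1.
Local Notation L2 := 'rV[F]_n2.
Local Notation L3 := 'rV[F]_n3.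
Variables (br1 : L1 -> L1 -> L2) (br2 : L2 -> L1 -> L3) (kap : L1 -> L1 -> L3).

(* Here L1, L2 and L3 stand for the first three lower central quotients, br1 and
   br2 for the commutator pairings, and kap x y for the class in L3 of the
   commutator of lifts of x and y; it depends on the lifts unless it is evaluated
   on the subspace Cs f by the functional f. *)
Definition Cs (f : L3) : {vspace L1} := subspace_of [pred a | [forall w, dot (br2 w a) f == 0]].
Definition Ys (x : L1) : {vspace L1} := subspace_of [pred y | br1 x y == 0].
Definition Phis (x : L1) : {vspace L3} := subspace_of [pred f | [forall w, dot (br2 w x) f == 0]].

(** Both surjectivity conditions encode the Camina property: [camina_br1_onto] for targets in L_2,
    [camina_kap_onto] for targets in L_3. The condition [camina_br2_gen] reflects that commutators
    generate L_3. *)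
Record camina_lie : Prop := CaminaLie {
  camina_prime : prime p;
  camina_br1A : additive2 br1;
  camina_br2A : additive2 br2;
  camina_br1xx : forall x, br1 x x = 0;
  camina_br1_onto : forall x, x != 0 -> forall w, exists y, br1 x y = w;
  camina_br2_gen : forall f, f != 0 -> exists w a, dot (br2 w a) f != 0;
  camina_jacobi : forall x y z, br2 (br1 x y) z + br2 (br1 y z) x + br2 (br1 z x) y = 0;
  camina_kap : forall f (U : {vspace L1}), (U <= Cs f)%VS -> {in U &, forall x y, br1 x y = 0} ->
    alternating_on U (fun u v => dot (kap u v) f);
  camina_kap_onto : forall f x, f != 0 -> x != 0 -> x \in Cs f ->
    exists2 y, br1 x y = 0 & dot (kap x y) f != 0
}.

Hypothesis camL : camina_lie.
Hypothesis n3_gt0 : (0 < n3)%N.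

Let p_pr := camina_prime camL.
Let br1A := camina_br1A camL.
Let br2A := camina_br2A camL.
Let br1xx := camina_br1xx camL.

Lemma br1N x y : br1 y x = - br1 x y.
Proof.
apply/eqP; rewrite -addr_eq0 addrC.
by have := br1xx (x + y); rewrite (additive2Dl br1A) !(additive2Dr br1A) !br1xx addr0 add0r => ->.
Qed.

Let dimL n : \dim {: 'rV[F]_n} = n.
Proof. by rewrite dimvf /dim /= mul1n. Qed.

Lemma dot_br2A f : additive2 (fun a w => dot (br2 w a) f).
Proof.
split=> [w x y|a x y] /=; first by rewrite (additive2Dr br2A) (additive2Dl (dotA _ _)).
by rewrite (additive2Dl br2A) (additive2Dl (dotA _ _)).
Qed.

Lemma CsP f a : reflect (forall w, dot (br2 w a) f = 0) (a \in Cs f).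
Proof.
rewrite mem_subspace_of /=.
- by apply: (iffP forallP) => H w; [apply/eqP; apply: H | rewrite /= H].
- by apply/forallP => w; rewrite (additive2_0l (dot_br2A f)).
- move=> u v /forallP u0 /forallP v0; apply/forallP => w.
  by rewrite (additive2Dl (dot_br2A f)) (eqP (u0 w)) (eqP (v0 w)) addr0.
Qed.

Lemma PhisP x f : (f \in Phis x) = (x \in Cs f).
Proof.
rewrite [LHS]mem_subspace_of /=.
- by apply/forallP/CsP => H w; [apply/eqP|rewrite H].
- by apply/forallP => w; rewrite (additive2_0r (dotA _ _)).
- move=> u v /forallP u0 /forallP v0; apply/forallP => w.
  by rewrite (additive2Dr (dotA _ _)) (eqP (u0 w)) (eqP (v0 w)) addr0.
Qed.

Lemma YsE x y : (y \in Ys x) = (br1 x y == 0).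
Proof.
rewrite mem_subspace_of //= ?(additive2_0r br1A) // => u v /eqP u0 /eqP v0.
by rewrite (additive2Dr br1A) u0 v0 addr0.
Qed.

Lemma exists_functional : exists f : L3, f != 0.
Proof.
exists (delta_mx 0 (Ordinal n3_gt0)); apply/eqP => /rowP/(_ (Ordinal n3_gt0)).
by rewrite !mxE !eqxx => /eqP; rewrite oner_eq0.
Qed.

(** A functional [phi] on L_2 yields the alternating form [dot (br1 u v) phi] on L_1, nondegenerate
    for [phi != 0] because [br1 u] is onto for [u != 0]. *)
Lemma dimL2_le : (2 * n2 <= n1)%N.
Proof.
have [f /(camina_br2_gen camL)[w [a wa0]]] := exists_functional.
have := @alternating_space_dim p n1 n2 fullv fullv (fun phi u v => dot (br1 u v) phi) p_pr.
rewrite !dimL; apply.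
- rewrite -dimv_eq0 dimL; apply: contraNneq wa0 => n1_0.
  have -> : a = 0 by apply: row_dim0.
  by rewrite (additive2_0l (dot_br2A f)).
- by move=> u v _ _ x y _ _; rewrite (additive2Dr (dotA _ _)).
- move=> phi _; split=> [v _ x y _ _|u _ x y _ _|u _].
  + by rewrite (additive2Dl br1A) (additive2Dl (dotA _ _)).
  + by rewrite (additive2Dr br1A) (additive2Dl (dotA _ _)).
  + by rewrite br1xx (additive2_0l (dotA _ _)).
- move=> phi _ /dot_neq0[w' w'0] u _ u0.
  by have [v Ev] := camina_br1_onto camL u0 w'; exists v; rewrite ?memvf // Ev.
Qed.

Lemma Cs_isotropic f a : {in Cs f &, forall u v, dot (br2 (br1 u v) a) f = 0}.
Proof.
move=> u v /CsP Cu /CsP Cv; have /(congr1 (fun z => dot z f)) := camina_jacobi camL u v a.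
by rewrite !(additive2Dl (dotA _ _)) Cu Cv !addr0 (additive2_0l (dotA _ _)).
Qed.

(** Three bounds meet: 2 dim C_f <= dim L_1, as C_f is isotropic for a nondegenerate form; dim L_1
    <= dim L_2 + dim C_f, as C_f is the kernel on L_1 of the pairing with L_2; and 2 dim L_2 <= dim
    L_1. *)
Lemma dim_Cs f : f != 0 -> \dim (Cs f) = n2 /\ n1 = (2 * n2)%N.
Proof.
move=> /[dup] f0 /(camina_br2_gen camL)[w [a wa0]].
have := @perp_dim p n1 n1 (fun u v => dot (br2 (br1 u v) a) f) (Cs f) 0 (Cs f).
rewrite dimv0 addn0 => /(_ _ (@Cs_isotropic f a)) le1.
have {}le1 : (\dim (Cs f) + \dim (Cs f) <= n1)%N.
  apply: le1; first split=> [v x y|u x y] /=.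
  - by rewrite (additive2Dl br1A) (additive2Dr (dot_br2A f)).
  - by rewrite (additive2Dr br1A) (additive2Dr (dot_br2A f)).
  move=> u uv0; rewrite memv0; apply: contraNT wa0 => u0.
  by have [v <-] := camina_br1_onto camL u0 w; rewrite uv0.
have := @perp_dim p n1 n2 _ fullv (Cs f) 0 (dot_br2A f).
rewrite dimv0 addn0 dimL => le2.
have {}le2 : (n1 <= n2 + \dim (Cs f))%N.
  apply: le2 => [u v _|u u0]; last exact/CsP.
  by rewrite memv0 => /eqP->; rewrite (additive2_0r (dot_br2A f)).
by have := dimL2_le; lia.
Qed.

(** Since L_1 / C_f and L_2 have the same dimension, the pairing between them defined by [f] is
    perfect. *)
Lemma L2_nondegenerate (f : L3) (w : L2) : f != 0 -> w != 0 -> exists a, dot (br2 w a) f != 0.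
Proof.
move=> f0 w0; apply/existsP; apply: contraNT w0 => /existsPn wa0.
have {}wa0 a : dot (br2 w a) f = 0 by have /negPn/eqP := wa0 a.
have := @perp_dim p n1 n2 _ fullv (Cs f) <[w]>%VS (dot_br2A f).
rewrite dimL dim_vline => H; have {H} : (n1 + (w != 0%R) <= n2 + \dim (Cs f))%N.
  apply: H => [u v _|u u0]; last exact/CsP.
  by case/vlineP=> k ->; rewrite (additive_scaleF _ _ ((dot_br2A f).2 u)) wa0 mulr0.
have [-> ->] := dim_Cs f0; lia.
Qed.

Lemma Cs_br1 f : f != 0 -> {in Cs f &, forall u v, br1 u v = 0}.
Proof.
move=> f0 u v Cu Cv; apply/eqP/contraT => /(L2_nondegenerate f0)[a].
by rewrite Cs_isotropic ?eqxx.
Qed.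

Lemma dim_L1 : n1 = (2 * n2)%N.
Proof. by have [f /dim_Cs[]] := exists_functional. Qed.

Lemma dim_Ys x : x != 0 -> \dim (Ys x) = n2.
Proof.
move=> x0; have [K [I [KE IP _]]] := rank_nullity fullv (br1A.2 x).
have -> : I = fullv.
  apply/eqP; rewrite eqEsubv subvf; apply/subvP => w _.
  by have [y <-] := camina_br1_onto camL x0 w; apply/IP/memvf.
have -> : K = Ys x by apply/vspaceP => y; rewrite KE memvf YsE.
by rewrite !dimL; have := dim_L1; lia.
Qed.

(** By [Cs_br1] the space [Cs f] lies in [Ys x], and both have dimension [n2]. Thus [Cs f] is
    determined by any of its nonzero elements. *)
Lemma Ys_Cs f x : f != 0 -> x != 0 -> x \in Cs f -> Ys x = Cs f.
Proof.
move=> f0 x0 Cx; apply/eqP; rewrite eq_sym eqEdim dim_Ys // (dim_Cs f0).1 leqnn andbT.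
by apply/subvP => y Cy; rewrite YsE (Cs_br1 f0).
Qed.

(** Every nonzero [g] in [Phis x] has [Cs g = Ys x], so the forms [dot (kap u v) g] all live on one
    space of dimension [n2] and are nondegenerate there. *)
Lemma dim_Phis x : x != 0 -> (2 * \dim (Phis x) <= n2)%N.
Proof.
move=> x0; have [->|[f Pf f0]] : Phis x = 0%VS \/ exists2 f, f \in Phis x & f != 0.
- have [->|nz] := eqVneq (Phis x) 0%VS; first by left.
  by right; exists (vpick (Phis x)); rewrite ?memv_pick ?vpick0.
- by rewrite dimv0.
have CsE g : g \in Phis x -> g != 0 -> Cs g = Ys x.
  by rewrite PhisP => Cx g0; rewrite (Ys_Cs g0).
rewrite -(dim_Ys x0).
apply: (@alternating_space_dim p _ _ _ _ (fun g u v => dot (kap u v) g)) => //.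
- by rewrite -dimv_eq0 dim_Ys //; apply: contraNneq x0 => n2_0; apply/eqP/row_dim0; rewrite dim_L1 n2_0.
- by move=> u v _ _ g h _ _; rewrite (additive2Dr (dotA _ _)).
- move=> g Pg; have [->|g0] := eqVneq g 0.
    by split=> [v _ u u' _ _|u _ v v' _ _|u _] /=; rewrite !(additive2_0r (dotA _ _)) ?addr0.
  apply: (camina_kap camL); first by rewrite (CsE g).
  by rewrite -(CsE g) //; apply: Cs_br1.
move=> g Pg g0 u Yu u0; have Cu : u \in Cs g by rewrite (CsE g).
have [v uv kuv] := camina_kap_onto camL g0 u0 Cu; exists v => //.
by rewrite -(CsE g) // -(Ys_Cs g0 u0) // YsE uv.
Qed.

(* Counts the pairs (x, f) of nonzero elements with x in Cs f in two ways. *)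
Lemma dim_L3 : (2 * n3 < 3 * n2)%N.
Proof.
have n2_gt0 : (0 < n2)%N.
  have [f /(camina_br2_gen camL)[w [a]]] := exists_functional.
  rewrite lt0n; apply: contra => /eqP/(row_dim0 w) ->.
  by rewrite (additive2_0r (dot_br2A f)).
pose h := n2./2.
have cnt : ((p ^ n3 - 1) * (p ^ n2 - 1) <= (p ^ (2 * n2) - 1) * (p ^ h - 1))%N.
  have card_nz n (A : {vspace 'rV[F]_n}) : #|[pred u | (u != 0) && (u \in A)]| = (p ^ \dim A - 1)%N.
    have := card_vspace A; rewrite card_Fp // => <-; rewrite [in RHS](cardD1 0) mem0v addKn.
    by apply: eq_card => u; rewrite !inE.
  have card0 n : #|[pred u : 'rV[F]_n | u != 0]| = (p ^ n - 1)%N.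
    have := card_nz n fullv; rewrite dimL => <-; apply: eq_card => u; rewrite !inE memvf andbT //.
  have -> : ((p ^ n3 - 1) * (p ^ n2 - 1) =
      \sum_(f : L3 | f != 0%R) \sum_(x : L1 | (x != 0%R) && (x \in Cs f)) 1)%N.
    rewrite -card0 -sum_nat_const; apply: eq_bigr => f f0.
    by rewrite sum1_card card_nz (dim_Cs f0).1.
  have -> : (\sum_(f : L3 | f != 0%R) \sum_(x : L1 | (x != 0%R) && (x \in Cs f)) 1
      = \sum_(x : L1 | x != 0%R) \sum_(f : L3 | (f != 0%R) && (f \in Phis x)) 1)%N.
    rewrite (exchange_big_dep (fun x : L1 => x != 0)) /=; last by move=> f x _ /andP[].
    apply: eq_bigr => x x0; apply: eq_bigl => f.
    by rewrite x0 PhisP.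
  rewrite -dim_L1 -card0 -sum_nat_const; apply: leq_sum => x x0.
  rewrite sum1_card card_nz leq_sub2r // leq_exp2l ?prime_gt1 //.
  by have := dim_Phis x0; rewrite /h; lia.
have p1 := prime_gt1 p_pr.
have hlt : (h < n2)%N by rewrite /h; lia.
(* Cancelling p^n2 - 1 in [cnt] leaves p^n3 - 1 <= (p^n2 + 1)(p^h - 1), and the right side is below
   p^(n2 + h) - 1 because h < n2. *)
suff lt3 : (n3 < n2 + h)%N by rewrite /h in lt3; lia.
rewrite -(ltn_exp2l _ _ p1).
have e2 : (p ^ (2 * n2) - 1 = (p ^ n2 + 1) * (p ^ n2 - 1))%N.
  by rewrite mul2n -addnn expnD; have := expn_gt0 p n2; nia.
have a0 : (0 < p ^ n2 - 1)%N by rewrite subn_gt0 -(exp1n n2) ltn_exp2r.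
move: cnt; rewrite e2 mulnAC leq_pmul2r // expnD.
have : (p ^ h < p ^ n2)%N by rewrite ltn_exp2l.
have : (0 < p ^ h)%N by rewrite expn_gt0; lia.
have : (0 < p ^ n3)%N by rewrite expn_gt0; lia.
nia.
Qed.

End CaminaLie.

(** * Class four is impossible for odd p *)

Section ClassFour.

Variables (p n1 n2 n3 : nat).
Local Notation F := 'F_p.
Local Notation L1 := 'rV[F]_n1.
Local Notation L2 := 'rV[F]_n2.
Local Notation L3 := 'rV[F]_n3.
Variables (br1 : L1 -> L1 -> L2) (br2 : L2 -> L1 -> L3) (kap : L1 -> L1 -> L3).
(* The pairings br3 and br22 into L_4 are composed with a functional on L_4. *)
Variables (br3 : L3 -> L1 -> F) (br22 : L2 -> L2 -> F).
Hypothesis camL : camina_lie br1 br2 kap.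
Hypothesis p_odd : odd p.
Hypothesis br3A : additive2 br3.
Hypothesis br22A : additive2 br22.
Hypothesis br22xx : forall w, br22 w w = 0.
Hypothesis br3_neq0 : exists l a, br3 l a != 0.
Hypothesis jacobi4 : forall w a b, br3 (br2 w a) b - br3 (br2 w b) a = br22 w (br1 a b).

Let p_pr := camina_prime camL.
Let br1A := camina_br1A camL.
Let br2A := camina_br2A camL.
Let br1xx := camina_br1xx camL.
Let dimL n : \dim {: 'rV[F]_n} = n.
Proof. by rewrite dimvf /dim /= mul1n. Qed.

Lemma br22N w w' : br22 w' w = - br22 w w'.
Proof.
apply/eqP; rewrite -addr_eq0 addrC; have := br22xx (w + w').
by rewrite (additive2Dl br22A) !(additive2Dr br22A) !br22xx addr0 add0r => ->.
Qed.

Lemma n3_gt0 : (0 < n3)%N.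
Proof.
have [l [a]] := br3_neq0; rewrite lt0n; apply: contra => /eqP/(row_dim0 l) ->.
by rewrite (additive2_0l br3A).
Qed.

Let dimL1 := dim_L1 camL n3_gt0.
Let dimL3 := dim_L3 camL n3_gt0.

Let two_neq0 : 2%:R != 0 :> F.
Proof.
rewrite -(dvdn_pcharf (pchar_Fp p_pr)) gtnNdvd // ltn_neqAle prime_gt1 // andbT.
by apply: contraTneq p_odd => <-.
Qed.

(** The functional on L_3 given by pairing with [a], written as a vector; through it the results on
    [Cs] and [Phis] apply to L_4. *)
Definition psi (a : L1) : L3 := \row_i br3 (delta_mx 0 i) a.

Lemma dot_psi z a : dot z (psi a) = br3 z a.
Proof.
rewrite [in RHS](row_sum_delta z) (additive_sum _ _ _ (br3A.1 a)).
by apply: eq_bigr => i _; rewrite (additive_scaleF _ _ (br3A.1 a)) mxE.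
Qed.

Lemma psiD : {morph psi : x y / x + y}.
Proof. by move=> x y; apply/rowP => i; rewrite !mxE (additive2Dr br3A). Qed.

Definition Ms : {vspace L1} := subspace_of [pred a | psi a == 0].
Definition Ws : {vspace L2} := subspace_of [pred w | [forall w', br22 w w' == 0]].
Definition Xs x : {vspace L1} := subspace_of [pred a | br1 x a \in Ws].

Lemma MsE a : (a \in Ms) = (psi a == 0).
Proof.
rewrite mem_subspace_of //= ?(additive_0 psiD) // => u v /eqP u0 /eqP v0.
by rewrite psiD u0 v0 addr0.
Qed.

Lemma br3_Ms z m : m \in Ms -> br3 z m = 0.
Proof. by rewrite MsE => /eqP m0; rewrite -dot_psi m0 (additive2_0r (dotA _ _)). Qed.

Lemma WsP w : reflect (forall w', br22 w w' = 0) (w \in Ws).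
Proof.
rewrite mem_subspace_of /=.
- by apply: (iffP forallP) => H w'; [apply/eqP; apply: H | rewrite /= H].
- by apply/forallP => w'; rewrite (additive2_0l br22A).
- move=> u v /forallP u0 /forallP v0; apply/forallP => w'.
  by rewrite (additive2Dl br22A) (eqP (u0 w')) (eqP (v0 w')) addr0.
Qed.

Lemma XsE x a : (a \in Xs x) = (br1 x a \in Ws).
Proof.
rewrite mem_subspace_of //= ?(additive2_0r br1A) ?mem0v // => u v u0 v0.
by rewrite (additive2Dr br1A) memvD.
Qed.

Lemma psi_neq0 a : a \notin Ms -> psi a != 0. Proof. by rewrite MsE. Qed.

Lemma br3_br2_Ms w m a : m \in Ms -> br3 (br2 w m) a = br22 w (br1 m a).
Proof. by move=> Mm; rewrite -jacobi4 (br3_Ms _ Mm) subr0. Qed.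

(** For [x] in [Ms], [jacobi4] turns [br3 (br2 w x) a] into [br22 w (br1 x a)], which vanishes for
    all [w] exactly when [br1 x a] is in the radical [Ws]. *)
Lemma psi_Phis x a : x \in Ms -> (psi a \in Phis br2 x) = (a \in Xs x).
Proof.
move=> Mx; rewrite (PhisP camL) XsE; apply/(CsP camL)/WsP => H w.
  by have := H w; rewrite dot_psi br3_br2_Ms // br22N => /eqP; rewrite oppr_eq0 => /eqP.
by rewrite dot_psi br3_br2_Ms // br22N H oppr0.
Qed.

Lemma Ms_sub_Xs x : x \in Ms -> (Ms <= Xs x)%VS.
Proof.
move=> Mx; apply/subvP => m; rewrite -psi_Phis // MsE => /eqP->.
exact: mem0v.
Qed.

(** As the kernel of [psi], [Ms] has dimension at least n1 - n3 = 2 n2 - n3, and 2 n3 < 3 n2. *)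
Lemma dim_Ms : (n2 < 2 * \dim Ms)%N.
Proof.
have [K [I [KE _ _]]] := rank_nullity fullv psiD.
have -> : K = Ms by apply/vspaceP => a; rewrite KE memvf MsE.
have := dimvS (subvf I); rewrite !dimL; move: dimL1 dimL3; lia.
Qed.

Lemma dim_Xs x : x != 0 -> \dim (Xs x) = (n2 + \dim Ws)%N.
Proof.
move=> x0; have [K [I [KE IP IE <-]]] := rank_nullity (Xs x) (br1A.2 x).
have -> : K = Ys br1 x.
  apply/vspaceP => a; rewrite KE (YsE camL) XsE andbC.
  by case: eqP => //= ->; rewrite mem0v.
rewrite (dim_Ys camL n3_gt0) //; congr (_ + \dim _)%N.
apply/vspaceP => w; apply/idP/idP => [/IE[a Xa <-]|Ww]; first by rewrite -XsE.
have [a Ea] := camina_br1_onto camL x0 w.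
by rewrite -Ea IP // XsE Ea.
Qed.

(** The map [psi] sends [Xs x] into [Phis x] with kernel [Ms], and 2 dim [Phis x] <= n2. *)
Lemma dim_Ms_Ws x : x \in Ms -> x != 0 -> (n2 + 2 * \dim Ws <= 2 * \dim Ms)%N.
Proof.
move=> Mx x0; have [K [I [KE _ IE]]] := rank_nullity (Xs x) psiD.
have -> : K = Ms.
  apply/vspaceP => a; rewrite KE -MsE andbC; case: (boolP (a \in Ms)) => //= Ma.
  by rewrite (subvP (Ms_sub_Xs Mx)).
have /dimvS : (I <= Phis br2 x)%VS.
  by apply/subvP => f /IE[a Xa <-]; rewrite psi_Phis.
have := dim_Phis camL n3_gt0 x0; rewrite dim_Xs //; lia.
Qed.

Lemma Cs_psi x a : x \in Ms -> x != 0 -> a \in Xs x -> a \notin Ms ->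
  Cs br2 (psi a) = Ys br1 x.
Proof.
move=> Mx x0 Xa nMa; rewrite (Ys_Cs camL n3_gt0 (psi_neq0 nMa) x0) //.
by rewrite -(PhisP camL) psi_Phis.
Qed.

Lemma Ms_br1 : {in Ms &, forall m m', br1 m m' \in Ws}.
Proof. by move=> m m' Mm Mm'; rewrite -XsE (subvP (Ms_sub_Xs Mm)). Qed.

(** In the Jacobi identity for [m], [m'], [a], paired with [a], two terms become values of [br22] by
    [br3_br2_Ms]; these are equal, whence the factor 2. *)
Lemma br3_square a : {in Ms &, forall m m',
  br3 (br2 (br1 m m') a) a = 2%:R * br22 (br1 m a) (br1 m' a)}.
Proof.
move=> m m' Mm Mm'.
have /(congr1 (fun z => br3 z a)) := camina_jacobi camL m m' a.
rewrite !(additive2Dl br3A) (additive2_0l br3A) (br3_br2_Ms _ a Mm) (br3_br2_Ms _ a Mm').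
rewrite (br1N camL m a) (additive2Nl br22A) (br22N (br1 m a)) => /eqP.
by rewrite -addrA addr_eq0 => /eqP ->; rewrite opprD opprK mulr_natl mulr2n.
Qed.

Lemma exists_notin_Ms : exists a, a \notin Ms.
Proof. by have [l [a la0]] := br3_neq0; exists a; apply: contra la0 => /br3_Ms->. Qed.

(* Otherwise Ms is a complement of each Cs (psi a), and br3_square makes br22 vanish. *)
Lemma Xs_nsub_Ms x : x \in Ms -> x != 0 -> ~~ (Xs x <= Ms)%VS.
Proof.
move=> Mx x0; apply/negP => sXM.
have dM : \dim Ms = (n2 + \dim Ws)%N.
  by rewrite -(dim_Xs x0); apply/anti_leq; rewrite !dimvS ?Ms_sub_Xs.
have XsM y : y \in Ms -> y != 0 -> Xs y = Ms.
  move=> My y0; apply/esym/eqP; rewrite eqEdim Ms_sub_Xs //= dim_Xs // dM.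
  exact: leqnn.
have [a nMa] := exists_notin_Ms.
have CM0 : (Cs br2 (psi a) :&: Ms = 0)%VS.
  apply/eqP; rewrite -subv0; apply/subvP => y; rewrite memv_cap memv0 => /andP[Cy My].
  apply: contraNT nMa => y0; rewrite -(XsM y) // -psi_Phis //.
  by rewrite (PhisP camL).
have := dimv_sum_cap (Cs br2 (psi a)) Ms; rewrite CM0 dimv0 addn0.
rewrite (dim_Cs camL n3_gt0 (psi_neq0 nMa)).1 dM => dCM.
have := dimvS (subvf (Cs br2 (psi a) + Ms)); rewrite dCM dimL dimL1 => dW.
have W0 : Ws = 0%VS by apply/eqP; rewrite -dimv_eq0; lia.
have [K [I [KE IP IE dKI]]] := rank_nullity Ms (br1A.1 a).
have K0 : K = 0%VS.
  apply/eqP; rewrite -subv0; apply/subvP => y; rewrite KE memv0 => /andP[My /eqP ya0].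
  by apply: contraNT nMa => y0; rewrite -(XsM y) // XsE ya0 mem0v.
have Ifull : I = fullv.
  by apply/eqP; rewrite eqEdim subvf dimL; move: dKI; rewrite K0 dimv0 dM; lia.
have n2_0 : n2 = 0%N.
  suff Wf : Ws = fullv by have := dimL n2; rewrite -Wf W0 dimv0.
  apply/vspaceP => w; rewrite memvf; apply/WsP => w'.
  have [m Mm <-] : exists2 m, m \in Ms & br1 m a = w by apply: IE; rewrite Ifull memvf.
  have [m' Mm' <-] : exists2 m, m \in Ms & br1 m a = w' by apply: IE; rewrite Ifull memvf.
  have := Ms_br1 Mm Mm'; rewrite W0 memv0 => /eqP mm0.
  apply/eqP; have /eqP := br3_square a Mm Mm'.
  rewrite mm0 (additive2_0l br2A) (additive2_0l br3A) eq_sym mulf_eq0.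
  by rewrite (negbTE two_neq0).
by move: dimL3; rewrite n2_0.
Qed.

Lemma exists_Cs_Ys x : x \in Ms -> x != 0 -> exists2 f, f != 0 & Cs br2 f = Ys br1 x.
Proof.
move=> Mx x0; have /subvPn[a Xa nMa] := Xs_nsub_Ms Mx x0.
by exists (psi a); [apply: psi_neq0 | apply: Cs_psi].
Qed.

Lemma Ys_eq x y : x \in Ms -> x != 0 -> y \in Ys br1 x -> y != 0 -> Ys br1 y = Ys br1 x.
Proof.
move=> Mx x0; have [f f0 <-] := exists_Cs_Ys Mx x0 => Cy y0.
exact: (Ys_Cs camL n3_gt0).
Qed.

(** Otherwise [br1] vanishes on [Ms], and for [a] outside [Ys x] the map [br1 _ a] embeds [Ms] in
    L_2 as a subspace isotropic for [br22], by [br3_square]. Then 2 dim [Ms] <= n2 + dim [Ws],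
    against [dim_Ms_Ws] and [dim_Ms]. *)
Lemma Ms_nsub_Ys x : x \in Ms -> x != 0 -> ~~ (Ms <= Ys br1 x)%VS.
Proof.
move=> Mx x0; apply/negP => sMY; have [f f0 CY] := exists_Cs_Ys Mx x0.
have /subvPn[a _ nYa] : ~~ (fullv <= Ys br1 x)%VS.
  apply/negP => /dimvS; rewrite dimL (dim_Ys camL n3_gt0) // dimL1.
  by have := dimL3; lia.
have [K [I [KE IP IE dKI]]] := rank_nullity Ms (br1A.1 a).
have K0 : K = 0%VS.
  apply/eqP; rewrite -subv0; apply/subvP => y; rewrite KE memv0 => /andP[My /eqP ya0].
  apply: contraNT nYa => y0; rewrite -(Ys_eq Mx x0 _ y0) ?(subvP sMY) //.
  by rewrite (YsE camL) ya0.
have := @perp_dim _ _ _ _ I Ws I br22A.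
move: dKI; rewrite K0 dimv0 add0n => -> => H.
have {H} : (\dim Ms + \dim Ms <= n2 + \dim Ws)%N.
  apply: H => [w w' /IE[m Mm <-] /IE[m' Mm' <-] | w w0]; last exact/WsP.
  have mm0 : br1 m m' = 0 by apply: (Cs_br1 camL n3_gt0 f0); rewrite CY (subvP sMY).
  apply/eqP; have /eqP := br3_square a Mm Mm'.
  by rewrite mm0 (additive2_0l br2A) (additive2_0l br3A) eq_sym mulf_eq0 (negbTE two_neq0).
have := dim_Ms_Ws Mx x0; have := dim_Ms; clear; lia.
Qed.

Section Quadratic.
Variable w : L2.
Hypotheses (Ww : w \in Ws) (w0 : w != 0).

(** As [w] lies in the radical of [br22], this form is symmetric by [jacobi4], and its radical is
    [Ms]. *)
Lemma brWA : additive2 (fun u v => br3 (br2 w u) v).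
Proof.
split=> [v x y|u x y] /=; last by rewrite (additive2Dr br3A).
by rewrite (additive2Dr br2A) (additive2Dl br3A).
Qed.

Lemma brW_sym u v : br3 (br2 w u) v = br3 (br2 w v) u.
Proof. by apply/eqP; rewrite -subr_eq0 jacobi4; move/WsP: Ww => ->. Qed.

Lemma brW_rad u : (forall v, br3 (br2 w u) v = 0) -> u \in Ms.
Proof.
move=> uv0; apply: contraT => /psi_neq0 pu0.
have [v] := L2_nondegenerate camL n3_gt0 pu0 w0.
by rewrite dot_psi brW_sym uv0 eqxx.
Qed.

Lemma brW_Ys x u a : x \in Ms -> x != 0 -> u \in Ys br1 x -> a \in Xs x ->
  br3 (br2 w u) a = 0.
Proof.
move=> Mx x0 Yu Xa; have [Ma|nMa] := boolP (a \in Ms); first exact: br3_Ms.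
by move: Yu; rewrite -(Cs_psi Mx x0 Xa nMa) => /(CsP camL)/(_ w); rewrite dot_psi.
Qed.

Lemma Ys_sub_Xs x : (Ys br1 x <= Xs x)%VS.
Proof. by apply/subvP => y; rewrite (YsE camL) XsE => /eqP->; apply: mem0v. Qed.

(** For the form of [w], [Ys x + Ms] is orthogonal to [Xs x] and contained in it. Pairing it with
    itself gives the first bound, pairing it with [Xs x] the second. *)
Lemma dim_YsMs x : x \in Ms -> x != 0 ->
  (\dim Ms <= 2 * \dim (Ys br1 x :&: Ms) /\ \dim Ws <= \dim (Ys br1 x :&: Ms))%N.
Proof.
move=> Mx x0; have dS := dimv_sum_cap (Ys br1 x) Ms.
rewrite (dim_Ys camL n3_gt0 x0) in dS.
have H A : (A <= Xs x)%VS -> (\dim A + \dim (Ys br1 x + Ms) <= n1 + \dim Ms)%N.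
  move=> sAX; apply: (perp_dim brWA) => [a b Aa|]; last exact: brW_rad.
  case/memv_addP=> y Yy [m Mm ->] /=; rewrite (additive2Dr br3A) (br3_Ms _ Mm) addr0.
  by rewrite brW_sym (brW_Ys Mx x0 Yy) // (subvP sAX).
have := H _ (subvv _); rewrite dim_Xs // => le1.
have := H (Ys br1 x + Ms)%VS; rewrite subv_add Ys_sub_Xs Ms_sub_Xs // => /(_ isT).
by move: dS le1 dimL1; lia.
Qed.

(* For nonzero y in Ms, \dim (Ys br1 y :&: Ms) = \dim Ws and br1 y maps Ms onto Ws, so
   the form of br3_square on Ms is nondegenerate, although it factors through a space
   of dimension n2 - \dim Ws, which is less than \dim Ms. *)
Lemma class_four_aux x : x \in Ms -> x != 0 -> False.
Proof.
move=> Mx x0; pose nu y := \dim (Ys br1 y :&: Ms).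
(* For [z] in [Ms] outside [Ys y], the intersections of [Ys y] and [Ys z] with [Ms] meet in 0, and
   each fills at least half of [Ms]. *)
have nuE y : y \in Ms -> y != 0 -> \dim Ms = (2 * nu y)%N.
  move=> My y0; have /subvPn[z Mz nYz] := Ms_nsub_Ys My y0.
  have z0 : z != 0 by apply: contraNneq nYz => ->; apply: mem0v.
  have [ly _] := dim_YsMs My y0; have [lz _] := dim_YsMs Mz z0.
  have YY0 : ((Ys br1 y :&: Ms) :&: (Ys br1 z :&: Ms) = 0)%VS.
    apply/eqP; rewrite -subv0; apply/subvP => u; rewrite !memv_cap memv0.
    case/andP=> /andP[Yyu _] /andP[Yzu _]; apply: contraNT nYz => u0.
    rewrite -(Ys_eq My y0 Yyu u0) (Ys_eq Mz z0 Yzu u0).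
    by rewrite (YsE camL) br1xx.
  have := dimv_sum_cap (Ys br1 y :&: Ms) (Ys br1 z :&: Ms).
  rewrite YY0 dimv0 addn0 => dS.
  have /dimvS : (Ys br1 y :&: Ms + Ys br1 z :&: Ms <= Ms)%VS by rewrite subv_add !capvSr.
  by rewrite dS /nu; move: ly lz; clear; lia.
have MsW y : y \in Ms -> y != 0 -> nu y = \dim Ws /\ exists2 m, m \in Ms & br1 y m = w.
  move=> My y0; have [K [I [KE IP IE dKI]]] := rank_nullity Ms (br1A.2 y).
  have KE' : K = (Ys br1 y :&: Ms)%VS.
    by apply/vspaceP => u; rewrite KE memv_cap (YsE camL) andbC.
  have sIW : (I <= Ws)%VS by apply/subvP => v /IE[m Mm <-]; apply: Ms_br1.
  have := dimvS sIW; have [_ lW] := dim_YsMs My y0.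
  move: dKI; rewrite KE' (nuE y My y0) /nu => dKI lI.
  split; first by move: lW lI dKI; clear; lia.
  apply: IE; suff -> : I = Ws by [].
  by apply/eqP; rewrite eqEdim sIW /=; move: lW lI dKI; clear; lia.
have dM : \dim Ms = (2 * \dim Ws)%N by rewrite (nuE x) // (MsW x Mx x0).1.
have le_n2 : (n2 <= 2 * \dim Ws)%N by have := dim_Ms_Ws Mx x0; lia.
(* By polarization a symmetric form with zero diagonal values vanishes, as 2 is invertible; but the
   radical [Ms] is proper. *)
have [a wa0] : exists a, br3 (br2 w a) a != 0.
  apply/existsP; apply: contraT => /existsPn waa0.
  have {}waa0 a : br3 (br2 w a) a = 0 by have /negPn/eqP := waa0 a.
  have [u] := exists_notin_Ms; case/negP; apply: brW_rad => v.
  have := waa0 (u + v); rewrite (additive2Dl brWA) !(additive2Dr brWA) !waa0.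
  rewrite add0r addr0 (brW_sym v u) -mulr2n -mulr_natl => /eqP.
  by rewrite mulf_eq0 (negbTE two_neq0) => /eqP.
have Ka m : m \in Ms -> br1 m a \in Ws -> m = 0.
  move=> Mm Wma; apply/eqP/contraT => m0; have [_ [m' Mm' Em']] := MsW m Mm m0.
  move: wa0; rewrite -Em' br3_square //; move/WsP: Wma => ->.
  by rewrite mulr0 eqxx.
have [K [I [KE IP IE dKI]]] := rank_nullity Ms (br1A.1 a).
have K0 : K = 0%VS.
  apply/eqP; rewrite -subv0; apply/subvP => y; rewrite KE memv0 => /andP[My /eqP ya0].
  by rewrite (Ka y) // ya0 mem0v.
have IW0 : (I :&: Ws = 0)%VS.
  apply/eqP; rewrite -subv0; apply/subvP => v; rewrite memv_cap memv0.
  case/andP=> /IE[m Mm <-] Wma; rewrite (Ka m Mm Wma).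
  by rewrite (additive2_0l br1A).
(* With d = dim [Ws], the independent spaces [I] and [Ws] have dimensions 2d and d, so 3d <= n2 <=
   2d, although [Ws] is nonzero. *)
have := dimv_sum_cap I Ws; rewrite IW0 dimv0 addn0.
have := dimvS (subvf (I + Ws)); rewrite dimL => leI dI.
move: dKI; rewrite K0 dimv0 add0n dM => dI2.
have : (0 < \dim Ws)%N by rewrite lt0n dimv_eq0; apply: contraTneq Ww => ->; rewrite memv0.
move: leI; rewrite dI dI2; move: le_n2; clear; lia.
Qed.

End Quadratic.

Lemma class_four_absurd : False.
Proof.
have [x Mx x0] : exists2 x, x \in Ms & x != 0.
  exists (vpick Ms); rewrite ?memv_pick // vpick0 -dimv_eq0.
  by have := dim_Ms; case: (\dim Ms); rewrite ?muln0.
have /subvPn[m Mm nYm] := Ms_nsub_Ys Mx x0.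
by apply: (class_four_aux (Ms_br1 Mx Mm)) Mx x0; rewrite -(YsE camL).
Qed.

End ClassFour.

(** * Class three is impossible for p = 2 *)

Section ClassThreeTwo.

Variables (n1 n2 n3 : nat).
Local Notation F := 'F_2.
Local Notation L1 := 'rV[F]_n1.
Local Notation L2 := 'rV[F]_n2.
Local Notation L3 := 'rV[F]_n3.
Variables (br1 : L1 -> L1 -> L2) (br2 : L2 -> L1 -> L3) (kap : L1 -> L1 -> L3).
Variables (f : L3) (s : L2 -> F).
Hypothesis camL : camina_lie br1 br2 kap.
Hypothesis f0 : f != 0.
(* In the group, s w is the value of f at the square of a lift of w. *)
Hypothesis sD : {morph s : x y / x + y}.
Hypothesis s_br1 : {in Cs br2 f, forall c a, s (br1 c a) = dot (br2 (br1 c a) a) f}.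

Let br1A := camina_br1A camL.
Let br2A := camina_br2A camL.
Let n3_gt0 : (0 < n3)%N.
Proof. by rewrite lt0n; apply: contra f0 => /eqP/(row_dim0 f) ->. Qed.
Let dimL n : \dim {: 'rV[F]_n} = n.
Proof. by rewrite dimvf /dim /= mul1n. Qed.
Let dimL1 := dim_L1 camL n3_gt0.
Let dimC := (dim_Cs camL n3_gt0 f0).1.

Local Notation C := (Cs br2 f).
Local Notation h c a b := (dot (br2 (br1 c a) b) f).

Let hA c : additive2 (fun a b => h c a b).
Proof.
split=> [v x y|u x y] /=; last by rewrite (additive2Dr br2A) (additive2Dl (dotA _ _)).
by rewrite (additive2Dr br1A) (additive2Dl br2A) (additive2Dl (dotA _ _)).
Qed.

Let h_sym c a b : c \in C -> h c a b = h c b a.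
Proof.
move=> /(CsP camL) Cc; have /(congr1 (fun z => dot z f)) := camina_jacobi camL c a b.
rewrite !(additive2Dl (dotA _ _)) Cc addr0 (additive2_0l (dotA _ _)) (br1N camL c b).
rewrite (additive2Nl br2A) (additive2Nl (dotA _ _)) => /eqP.
by rewrite subr_eq0 => /eqP.
Qed.

Let hC c a v : v \in C -> h c a v = 0. Proof. by move/(CsP camL) => ->. Qed.

Let h_rad c a : c \in C -> c != 0 -> a \notin C -> exists v, h c a v != 0.
Proof.
move=> Cc c0 nCa; apply: (L2_nondegenerate camL n3_gt0 f0).
by apply: contraNneq nCa => ca0; rewrite -(Ys_Cs camL n3_gt0 f0 c0 Cc) (YsE camL) ca0.
Qed.

Let n2_gt0 : (0 < n2)%N.
Proof. by have := dim_L3 camL n3_gt0; lia. Qed.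

(** Since [Cs f] has codimension [n2] in L_1, every functional on L_2 arises from pairing with some
    [b]. *)
Let s_rep : exists b, forall w, s w = dot (br2 w b) f.
Proof.
pose g a : L2 := \row_i dot (br2 (delta_mx 0 i) a) f.
have gE w a : dot (br2 w a) f = dot w (g a).
  rewrite [in LHS](row_sum_delta w).
  rewrite (additive_sum _ _ _ ((dot_br2A camL f).2 a)); apply: eq_bigr => i _.
  by rewrite (additive_scaleF _ _ ((dot_br2A camL f).2 a)) mxE.
have gD : {morph g : x y / x + y}.
  by move=> x y; apply/rowP => i; rewrite !mxE (additive2Dl (dot_br2A camL f)).
have [K [I [KE IP IE dKI]]] := rank_nullity fullv gD.
have KC : K = C.
  apply/vspaceP => a; rewrite KE memvf /=; apply/eqP/(CsP camL) => [ga0 w|Ca].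
    by rewrite gE ga0 (additive2_0r (dotA _ _)).
  by apply/rowP => i; rewrite mxE Ca mxE.
have If : I = fullv.
  apply/eqP; rewrite eqEdim subvf dimL /=; move: dKI dimL1.
  by rewrite KC dimC dimL; clear; lia.
have [b _ gb] : exists2 b, b \in fullv & g b = \row_i s (delta_mx 0 i) by apply: IE; rewrite If memvf.
exists b => w; rewrite gE gb [in LHS](row_sum_delta w) (additive_sum _ _ _ sD).
by apply: eq_bigr => i _; rewrite (additive_scaleF _ _ sD) mxE.
Qed.

(** With [b] representing [s], [h c a a = h c a b] for [c] in C. If [b] is in C, the forms [h c] are
    alternating on a complement of C of dimension [n2] and form a space of dimension [n2], which is
    too large. Otherwise [kap] makes [n2] even, while for a suitable [c] the form [h c] is
    alternating and nondegenerate on a complement of C in the hyperplane orthogonal to [b], of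
    dimension n2 - 1. *)
Lemma class_three_two_absurd : False.
Proof.
have [b sE] := s_rep.
have hb c a : c \in C -> h c a a = h c a b by move=> Cc; rewrite -s_br1 // sE.
have [Cb|nCb] := boolP (b \in C).
  have := @alternating_space_dim 2 _ _ (C^C)%VS C (fun c u v => h c u v) isT.
  have dCC : \dim (C^C)%VS = n2.
    by rewrite dimv_compl dimL dimC; move: dimL1; clear; lia.
  rewrite dCC dimC => H; suff : (2 * n2 <= n2)%N by move: n2_gt0; clear; lia.
  apply: H => [|u v _ _ x y _ _|c Cc|c Cc c0 u Au u0].
  - by rewrite -dimv_eq0 dCC -lt0n.
  - by rewrite (additive2Dl br1A) (additive2Dl br2A) (additive2Dl (dotA _ _)).
  - split=> [v _ x y _ _|u _ x y _ _|u _]; first by rewrite (additive2Dl (hA c)).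
      by rewrite (additive2Dr (hA c)).
    by rewrite hb // hC.
  have nCu : u \notin C.
    by apply: contra u0 => Cu; rewrite -memv0 -(capv_compl C) memv_cap Cu.
  have [v huv] := h_rad Cc c0 nCu.
  have /memv_addP[v1 Cv1 [v2 Av2 Ev]] : v \in (C + C^C)%VS by rewrite addv_complf memvf.
  by exists v2 => //; move: huv; rewrite Ev (additive2Dr (hA c)) hC // add0r.
have even_n2 : ~~ odd n2.
  rewrite -dimC; apply: (@alternating_even_F2 _ _ (fun u v => dot (kap u v) f)).
    by apply: (camina_kap camL) => //; apply: Cs_br1 camL n3_gt0 _ f0.
  move=> u Cu u0; have [v uv kuv] := camina_kap_onto camL f0 u0 Cu.
  by exists v; rewrite // -(Ys_Cs camL n3_gt0 f0 u0 Cu) (YsE camL) uv.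
have [c Cc hcbb] : exists2 c, c \in C & h c b b != 0.
  have [K [I [KE IP IE dKI]]] := rank_nullity C (br1A.1 b).
  have K0 : K = 0%VS.
    apply/eqP; rewrite -subv0; apply/subvP => c; rewrite KE memv0 => /andP[Cc /eqP cb0].
    by apply: contraNT nCb => c0; rewrite -(Ys_Cs camL n3_gt0 f0 c0 Cc) (YsE camL) cb0.
  have If : I = fullv.
    by apply/eqP; rewrite eqEdim subvf dimL /=; move: dKI; rewrite K0 dimv0 dimC add0n => ->.
  have [w wb0] : exists w, dot (br2 w b) f != 0.
    apply/existsP; apply: contraNT nCb => /existsPn wb0; apply/(CsP camL) => w.
    by have /negPn/eqP := wb0 w.
  have [c Cc Ec] : exists2 c, c \in C & br1 c b = w by apply: IE; rewrite If memvf.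
  by exists c => //; rewrite Ec.
have c0 : c != 0.
  by apply: contraNneq hcbb => ->; rewrite (additive2_0l br1A) (additive2_0l br2A)
    (additive2_0l (dotA _ _)).
pose g a : 'rV[F]_1 := \row__ h c a b.
have gD : {morph g : x y / x + y}.
  by move=> x y; apply/rowP => i; rewrite !mxE (additive2Dl (hA c)).
have [B [I [BE IP _ dBI]]] := rank_nullity fullv gD.
have {}BE a : (a \in B) = (h c a b == 0).
  rewrite BE memvf /=; apply/eqP/eqP => [/rowP/(_ 0)|ab0]; first by rewrite !mxE.
  by apply/rowP => i; rewrite !mxE.
have sCB : (C <= B)%VS by apply/subvP => a Ca; rewrite BE h_sym // hC.
have dB : (\dim B).+1 = n1.
  have := dimvS (subvf I); rewrite !dimL => leI.
  have : (0 < \dim I)%N.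
    rewrite lt0n dimv_eq0; apply: contraNneq hcbb => I0.
    by have := IP b (memvf b); rewrite I0 memv0 => /eqP/rowP/(_ 0); rewrite !mxE => ->.
  by move: dBI leI; rewrite dimL; clear; lia.
have dD : (\dim (B :\: C)%VS).+1 = n2.
  have := dimv_cap_compl B C; rewrite (capv_idPr sCB) dimC.
  by move: dB dimL1; clear; lia.
have nD : nondegenerate_on (B :\: C)%VS (fun u v => h c u v).
  move=> u Du u0.
  have Bu : u \in B by apply: (subvP (diffvSl B C)).
  have nCu : u \notin C.
    by apply: contra u0 => Cu; rewrite -memv0 -(capv_diff B C) memv_cap Du.
  have [v huv] := h_rad Cc c0 nCu.
  (* A multiple of [b] corrects [v] into [B] without changing its pairing with [u], which is
     orthogonal to [b]. *)
  pose k := h c v b / h c b b.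
  have Bv : v - k *: b \in B.
    rewrite BE (additive2Dl (hA c)) (additive2Nl (hA c)).
    by rewrite (additive_scaleF _ _ ((hA c).1 b)) divfK // subrr.
  have : v - k *: b \in (B :\: C + C)%VS by rewrite addv_diff (subvP (addvSl B C)).
  case/memv_addP=> v1 Dv1 [v2 Cv2 Ev]; exists v1 => //.
  suff -> : h c u v1 = h c u v by [].
  have ub0 : h c u b = 0 by apply/eqP; rewrite -BE.
  transitivity (h c u (v - k *: b)); first by rewrite Ev (additive2Dr (hA c)) (hC _ _ Cv2) addr0.
  rewrite (additive2Dr (hA c)) (additive2Nr (hA c)).
  by rewrite (additive_scaleF _ _ ((hA c).2 u)) ub0 mulr0 oppr0 addr0.
have : ~~ odd (\dim (B :\: C)%VS).
  apply: (alternating_even_F2 _ nD); split=> [v _ x y _ _|u _ x y _ _|u Du].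
  - by rewrite (additive2Dl (hA c)).
  - by rewrite (additive2Dr (hA c)).
  - by rewrite hb //; apply/eqP; rewrite -BE (subvP (diffvSl B C)).
by move: even_n2; have := congr1 odd dD; rewrite /= => <- /negPn ->.
Qed.

End ClassThreeTwo.

Local Close Scope ring_scope.
Local Open Scope group_scope.

(** * Lower central series of a Camina group *)

Lemma three_subgroup_sub (gT : finGroupType) (G H K N : {group gT}) :
  G \subset 'N(N) -> H \subset 'N(N) -> K \subset 'N(N) ->
  [~: G, H, K] \subset N -> [~: H, K, G] \subset N -> [~: K, G, H] \subset N.
Proof.
move=> nG nH nK.
have nR (A B : {set gT}) : A \subset 'N(N) -> B \subset 'N(N) -> [~: A, B] \subset 'N(N).
  exact: comm_subG.
have sub3 (A B C : {group gT}) : A \subset 'N(N) -> B \subset 'N(N) -> C \subset 'N(N) ->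
    ([~: A, B, C] \subset N) = ([~: A / N, B / N, C / N] == 1).
  move=> nA nB nC; rewrite -quotientR // -quotientR ?nR // -subG1 quotient_sub1 //.
  by rewrite nR // nR.
rewrite !sub3 // => /eqP c1 /eqP c2; exact/eqP/three_subgroup.
Qed.

Section LowerCentral.

Variables (gT : finGroupType) (P : {group gT}).
Local Notation L n := 'L_n(P).

Lemma lcn_comm i j : [~: L i.+1, L j.+1] \subset L (i + j).+2.
Proof.
elim: j i => [|j IHj] i; first by rewrite addn0 -lcnSn.
rewrite [L j.+2]lcnSn commGC.
have nL k l : L k \subset 'N(L l) by rewrite (subset_trans (lcn_sub _ _)) ?lcn_norm.
apply: (@three_subgroup_sub _ P 'L_i.+1(P)%G 'L_j.+1(P)%G 'L_(i + j.+1).+2(P)%G) => //=.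
- exact: lcn_norm.
- by rewrite [[~: P, _]]commGC -lcnSn addnS -addSn.
- by rewrite addnS [L _.+3]lcnSn commSg.
Qed.

Lemma mem_lcn_comm i j x y : x \in L i.+1 -> y \in L j.+1 -> [~ x, y] \in L (i + j).+2.
Proof. by move=> Lx Ly; apply: (subsetP (lcn_comm i j)); rewrite mem_commg. Qed.

Lemma mem_lcnS k x y : x \in L k.+1 -> y \in P -> [~ x, y] \in L k.+2.
Proof. by move=> Lx Py; have := @mem_lcn_comm k 0 x y Lx Py; rewrite addn0. Qed.

(** A homomorphism on L_k / L_(k+1), kept as a function on the whole group to avoid cosets; its
    values outside L_k are arbitrary. *)
Definition graded_hom (V : zmodType) k (phi : gT -> V) : Prop :=
  {in L k &, forall x y, phi (x * y)%g = phi x + phi y}%R /\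
  {in L k.+1, forall x, phi x = 0%R}.

Section GradedHom.

Variables (V : zmodType) (k : nat) (phi : gT -> V).
Hypothesis phiH : graded_hom k.+1 phi.
Local Open Scope ring_scope.

Lemma gradedM : {in L k.+1 &, forall x y, phi (x * y)%g = phi x + phi y}.
Proof. exact: phiH.1. Qed.

Lemma graded0 : {in L k.+2, forall x, phi x = 0}. Proof. exact: phiH.2. Qed.

Lemma graded1 : phi 1%g = 0. Proof. by rewrite graded0 ?group1. Qed.

Lemma gradedV : {in L k.+1, forall x, phi x^-1%g = - phi x}.
Proof.
by move=> x Lx; apply: (addIr (phi x)); rewrite -gradedM ?groupV // mulVg graded1 addNr.
Qed.

Lemma gradedX n : {in L k.+1, forall x, phi (x ^+ n)%g = phi x *+ n}.
Proof.
move=> x Lx; elim: n => [|n IHn]; first by rewrite graded1.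
by rewrite expgS gradedM ?groupX // IHn mulrS.
Qed.

Lemma gradedJ : {in L k.+1 & P, forall x g, phi (x ^ g)%g = phi x}.
Proof.
move=> x g Lx Pg; have Lxg : [~ x, g] \in L k.+2 by have := @mem_lcn_comm k 0 x g Lx Pg; rewrite addn0.
by rewrite conjg_mulR gradedM ?(subsetP (lcn_subS _ _) _ Lxg) // [phi [~ _, _]]graded0 // addr0.
Qed.

Lemma lcn_mem_P n x : x \in L n -> x \in P. Proof. exact: subsetP (lcn_sub n P) x. Qed.

Lemma graded_comm_swap x y : [~ x, y] \in L k.+1 -> phi [~ y, x] = - phi [~ x, y].
Proof. by move=> Lxy; rewrite -invg_comm gradedV. Qed.

Section Comm.
Variables i j : nat.
Hypothesis ijk : (i + j).+1 = k.
Let Lij x y : x \in L i.+1 -> y \in L j.+1 -> [~ x, y] \in L k.+1.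
Proof. by rewrite -ijk; apply: mem_lcn_comm. Qed.

Lemma graded_commMl x x' y : x \in L i.+1 -> x' \in L i.+1 -> y \in L j.+1 ->
  phi [~ x * x', y] = phi [~ x, y] + phi [~ x', y].
Proof.
move=> Lx Lx' Ly; rewrite commMgJ gradedM ?gradedJ ?Lij // ?(lcn_mem_P Lx') //.
by rewrite memJ_norm ?Lij // (subsetP (lcn_norm _ _)) ?(lcn_mem_P Lx').
Qed.

Lemma graded_commMr x y y' : x \in L i.+1 -> y \in L j.+1 -> y' \in L j.+1 ->
  phi [~ x, y * y'] = phi [~ x, y] + phi [~ x, y'].
Proof.
move=> Lx Ly Ly'; rewrite commgMJ gradedM ?gradedJ ?Lij // ?(lcn_mem_P Ly') //.
  by rewrite addrC.
by rewrite memJ_norm ?Lij // (subsetP (lcn_norm _ _)) ?(lcn_mem_P Ly').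
Qed.

Lemma graded_comm0l x y : x \in L i.+2 -> y \in L j.+1 -> phi [~ x, y] = 0.
Proof. by move=> Lx Ly; rewrite graded0 // -ijk -addSn mem_lcn_comm. Qed.

Lemma graded_comm0r x y : x \in L i.+1 -> y \in L j.+2 -> phi [~ x, y] = 0.
Proof. by move=> Lx Ly; rewrite graded0 // -ijk -addnS mem_lcn_comm. Qed.

Lemma graded_commVl x y : x \in L i.+1 -> y \in L j.+1 -> phi [~ x^-1, y] = - phi [~ x, y].
Proof.
move=> Lx Ly; apply: (addIr (phi [~ x, y])).
by rewrite -graded_commMl ?groupV // mulVg comm1g graded1 addNr.
Qed.

End Comm.

Lemma graded_eq0 : (forall x y, x \in L k -> y \in P -> phi [~ x, y] = 0) -> (0 < k)%N ->
  {in L k.+1, forall z, phi z = 0}.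
Proof.
case: k phiH => // k' phiH' comm0 _.
pose K := [set z in L k'.+2 | phi z == 0].
have gK : group_set K.
  apply/group_setP; split=> [|x y]; first by rewrite inE group1 phiH'.2 ?group1 //=.
  rewrite !inE => /andP[Lx /eqP x0] /andP[Ly /eqP y0].
  by rewrite groupM //= phiH'.1 // x0 y0 addr0.
move=> z; rewrite [L _]lcnSn -[z \in _]/(z \in gval _) => Lz.
have /subsetP/(_ z Lz) : [~: L k'.+1, P] \subset Group gK.
  rewrite gen_subG; apply/subsetP => _ /imset2P[x y Lx Py ->].
  by rewrite inE [L _]lcnSn mem_commg //= comm0.
by rewrite inE => /andP[_ /eqP].
Qed.

End GradedHom.

(** The image of the Hall-Witt identity: [phi] does not see conjugation, and inverting the middle
    entry changes the sign. *)
Lemma graded_jacobi (V : zmodType) (phi : gT -> V) i j k x y z :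
  graded_hom (i + j + k).+3 phi ->
  x \in L i.+1 -> y \in L j.+1 -> z \in L k.+1 ->
  (phi [~ [~ x, y], z] + phi [~ [~ y, z], x] + phi [~ [~ z, x], y] = 0)%R.
Proof.
move=> phiH Lx Ly Lz.
have step a b c (u v w : gT) : (a + b + c = i + j + k)%N ->
    u \in L a.+1 -> v \in L b.+1 -> w \in L c.+1 ->
    [~ [~ u, v^-1], w] \in L (i + j + k).+3 /\ phi ([~ [~ u, v^-1], w] ^ v) = (- phi [~ [~ u, v], w])%R.
  move=> abc Lu Lv Lw.
  have Luv : [~ u, v^-1] \in L (a + b).+2 by rewrite mem_lcn_comm ?groupV.
  have L3 : [~ [~ u, v^-1], w] \in L (i + j + k).+3 by rewrite -abc -addSn mem_lcn_comm.
  split=> //; rewrite (gradedJ phiH) ?(lcn_mem_P Lv) //.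
  have Lc : [~ u, v] \in L (a + b).+2 by rewrite mem_lcn_comm.
  have Lcv : [~ [~ u, v], v^-1] \in L (a + b).+3.
    by have := @mem_lcn_comm _ 0 _ v^-1 Lc; rewrite addn0 groupV => -> //; apply: lcn_mem_P Lv.
  have -> : [~ u, v^-1] = ([~ u, v] * [~ [~ u, v], v^-1])^-1.
    by rewrite -conjg_mulR; apply: (mulIg ([~ u, v] ^ v^-1)); rewrite -commgMJ mulgV mulVg commg1.
  have abk : ((a + b).+1 + c).+1 = (i + j + k).+2 by rewrite addSn abc.
  have Lcv' := subsetP (lcn_subS _ _) _ Lcv.
  rewrite (graded_commVl phiH abk) ?(groupM Lc Lcv') // (graded_commMl phiH abk) //.
  by rewrite (graded_comm0l phiH abk Lcv Lw) addr0.
have [L1 E1] := step i j k x y z erefl Lx Ly Lz.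
have [L2 E2] := step j k i y z x ltac:(lia) Ly Lz Lx.
have [L3 E3] := step k i j z x y ltac:(lia) Lz Lx Ly.
have := congr1 phi (Hall_Witt_identity x y z).
have nP g h : g \in L (i + j + k).+3 -> h \in P -> g ^ h \in L (i + j + k).+3.
  by move=> Lg Ph; rewrite memJ_norm // (subsetP (lcn_norm _ _)).
have J1 := nP _ _ L1 (lcn_mem_P Ly); have J2 := nP _ _ L2 (lcn_mem_P Lz).
have J3 := nP _ _ L3 (lcn_mem_P Lx).
rewrite (graded1 phiH) (gradedM phiH (groupM J1 J2) J3) (gradedM phiH J1 J2) E1 E2 E3.
by rewrite -!opprD => /eqP; rewrite oppr_eq0 => /eqP.
Qed.

End LowerCentral.

(** * Powers in Camina p-groups *)

Section CaminaGroup.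

Variables (p : nat) (gT : finGroupType) (P : {group gT}).
Hypothesis p_pr : prime p.
Hypothesis camP : camina_pgroup p P.
Local Notation L n := 'L_n(P).

Let pP : p.-group P := camP.1.
Let nilP : nilpotent P := pgroup_nil pP.

Lemma camina_comm x z : x \in P -> x \notin P^`(1) -> z \in P^`(1) ->
  exists2 y, y \in P & [~ x, y] = z.
Proof.
move=> Px nP'x P'z; have := camP.2.2 x; rewrite inE nP'x Px => /(_ isT) clx.
have : x * z \in x ^: P by rewrite clx mem_lcoset mulKg.
by case/imsetP=> y Py xz; exists y; rewrite // commgEl -xz mulKg.
Qed.

Lemma lcn_properS k : L k.+1 != 1 -> ~~ (L k.+1 \subset L k.+2).
Proof.
move=> nt; apply/negP => sLL.
have nLP : P \subset 'N_P(L k.+1) by rewrite subsetI subxx lcn_norm.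
have /proper_subn := nil_comm_properl nilP (lcn_sub k.+1 P) nt nLP.
by rewrite -lcnSn sLL.
Qed.

Lemma der_neq1 : P^`(1) != 1.
Proof. by apply: contra camP.2.1 => /eqP/derG1P. Qed.

(** Otherwise every element of P' is some [x^p, y], congruent to [x, y]^p modulo L_3. The p-group
    L_2 / L_3 then consists of p-th powers, hence is trivial. *)
Lemma camina_expg_der x : x \in P -> x ^+ p \in P^`(1).
Proof.
move=> Px; apply: contraT => nP'xp.
have nP'x : x \notin P^`(1) by apply: contra nP'xp => P'x; rewrite groupX.
have Pxp : x ^+ p \in P by rewrite groupX.
have nL3 g : g \in P -> g \in 'N(L 3) by apply: subsetP; apply: lcn_norm.
have abA : abelian (L 2 / L 3).
  by rewrite sub_der1_abelian // (subset_trans (lcn_comm P 1 1)) ?lcn_sub_leq.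
have pA : p.-group (L 2 / L 3) by rewrite quotient_pgroup // (pgroupS (lcn_sub 2 P)).
have sAM : L 2 / L 3 \subset 'Mho^1(L 2 / L 3).
  apply/subsetP => _ /morphimP[z _ Lz ->].
  have [y Py <-] := camina_comm Pxp nP'xp Lz.
  have Lxy : [~ x, y] \in L 2 by rewrite [L 2]lcnSn mem_commg.
  have Axy : coset (L 3) [~ x, y] \in L 2 / L 3.
    by rewrite mem_quotient.
  rewrite [X in X \in _](_ : _ = coset (L 3) [~ x, y] ^+ p).
    by have := Mho_p_elt 1 Axy (mem_p_elt pA Axy); rewrite expn1.
  rewrite !morphR ?nL3 // morphX ?nL3 // commXg //; apply/commgP.
  rewrite -!morphR ?groupR ?nL3 //; apply/eqP/coset_id.
  exact: (@mem_lcn_comm _ P 0 1).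
have /eqP A1 : L 2 / L 3 == 1.
  by apply: contraLR sAM => ntA; rewrite -(Phi_Mho pA abA) proper_subn // Phi_proper.
have sL23 : L 2 \subset L 3.
  by rewrite -quotient_sub1 ?A1 // (subset_trans (lcn_sub _ _)) ?lcn_norm.
by case/negP: (@lcn_properS 1 der_neq1).
Qed.

(** By induction: L_(k+2) is generated by commutators [w, a] with [w] in L_(k+1), and [w, a]^p is
    congruent to [w^p, a] modulo L_(k+3). *)
Lemma camina_expg k x : x \in L k.+1 -> x ^+ p \in L k.+2.
Proof.
elim: k x => [|k IHk] x; first by rewrite lcn1; apply: camina_expg_der.
have nL g : g \in P -> g \in 'N(L k.+3) by apply: subsetP; apply: lcn_norm.
have abA : abelian (L k.+2 / L k.+3).
  rewrite sub_der1_abelian // (subset_trans (lcn_comm P k.+1 k.+1)) //.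
  by apply: lcn_sub_leq; lia.
pose K := [set z in L k.+2 | z ^+ p \in L k.+3].
have gK : group_set K.
  apply/group_setP; split=> [|y z]; first by rewrite inE !group1 expg1n group1.
  rewrite !inE => /andP[Ly yp] /andP[Lz zp]; rewrite groupM //=.
  have [Py Pz] := (lcn_mem_P Ly, lcn_mem_P Lz).
  apply: coset_idr; first by rewrite nL ?groupX ?groupM.
  rewrite morphX ?nL ?groupM // morphM ?nL // expgMn; last first.
    by apply: (centsP abA); rewrite mem_quotient.
  by rewrite -!morphX ?nL //= !coset_id // mulg1.
move=> Lx; suff /subsetP/(_ x Lx) : L k.+2 \subset Group gK by rewrite inE => /andP[].
rewrite [L k.+2]lcnSn gen_subG; apply/subsetP => _ /imset2P[w a Lw Pa ->].
have Lwa : [~ w, a] \in L k.+2 by rewrite [L _]lcnSn mem_commg.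
have Pw := lcn_mem_P Lw; rewrite inE Lwa /=.
have Lwwa : [~ w, [~ w, a]] \in L k.+3.
  have := @mem_lcn_comm _ P k k.+1 w _ Lw Lwa; apply: subsetP.
  by apply: lcn_sub_leq; lia.
apply: coset_idr; first by rewrite nL ?groupX ?groupR.
rewrite morphX ?nL ?groupR // morphR ?nL // -commXg; last first.
  by apply/commgP; rewrite -!morphR ?nL ?groupR //= coset_id.
rewrite -morphX ?nL //= -morphR ?nL ?groupX //= coset_id // [L k.+3]lcnSn mem_commg //.
exact: IHk.
Qed.

End CaminaGroup.

(** An isomorphism of L_k / L_(k+1) with a row space, read on group elements. *)
Definition graded_coord (p : nat) (gT : finGroupType) (P : {group gT}) k n
    (l : gT -> 'rV['F_p]_n) : Prop :=
  [/\ graded_hom P k l, {in 'L_k(P), forall x, l x = 0%R -> x \in 'L_k.+1(P)} &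
      forall v, exists2 x, x \in 'L_k(P) & l x = v].

Section Coordinates.

Variables (p : nat) (gT : finGroupType) (P : {group gT}).
Hypothesis p_pr : prime p.
Hypothesis camP : camina_pgroup p P.
Local Notation L n := 'L_n(P).

Lemma lcn_quotient_abelem k : p.-abelem (L k.+1 / L k.+2).
Proof.
rewrite abelemE // sub_der1_abelian /=; last first.
  by apply: subset_trans (lcn_comm P k k) _; apply: lcn_sub_leq; lia.
apply/exponentP => _ /morphimP[x Nx Lx ->].
by rewrite -morphX //= coset_id // (camina_expg p_pr camP).
Qed.

Lemma exists_graded_coord k : exists n (l : gT -> 'rV['F_p]_n), graded_coord P k.+1 l.
Proof.
have abE := lcn_quotient_abelem k; set E := (L k.+1 / L k.+2)%G in abE.
have nL : L k.+1 \subset 'N(L k.+2) by rewrite (subset_trans (lcn_sub _ _)) ?lcn_norm.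
have [E1|ntE] := eqVneq (gval E) 1.
  have sLL : L k.+1 \subset L k.+2 by rewrite -quotient_sub1 // -[_ / _]/(gval E) E1.
  exists 0, (fun=> 0%R); split; first by split=> [x y _ _|x _]; rewrite ?addr0.
    by move=> x Lx _; apply: (subsetP sLL).
  by move=> v; exists 1; rewrite ?group1 //; apply/rowP => -[].
exists _, (fun x => abelem_rV abE ntE (coset (L k.+2) x)).
have EL x : x \in L k.+1 -> coset (L k.+2) x \in E by apply: mem_quotient.
split.
- split=> [x y Lx Ly|x Lx]; last by rewrite coset_id // abelem_rV_1.
  by rewrite morphM ?(subsetP nL) // abelem_rV_M ?EL.
- move=> x Lx /eqP; rewrite -(abelem_rV_1 abE ntE).
  rewrite (inj_in_eq (@abelem_rV_inj _ _ _ abE ntE)) ?group1 ?EL //.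
  by move/eqP/coset_idr; apply; rewrite (subsetP nL).
- move=> v; have : v \in abelem_rV abE ntE @* E by rewrite im_abelem_rV inE.
  by case/morphimP=> _ _ /morphimP[x _ Lx ->] ->; exists x.
Qed.

End Coordinates.

(** * Commutator pairings of a Camina p-group *)

Section CaminaLieInstance.

Variables (p : nat) (gT : finGroupType) (P : {group gT}).
Hypothesis p_pr : prime p.
Hypothesis camP : camina_pgroup p P.
Local Notation L n := 'L_n(P).
Local Notation F := 'F_p.

Variables (n1 n2 n3 : nat).
Variables (l1 : gT -> 'rV[F]_n1) (l2 : gT -> 'rV[F]_n2) (l3 : gT -> 'rV[F]_n3).
Hypotheses (l1P : graded_coord P 1 l1) (l2P : graded_coord P 2 l2) (l3P : graded_coord P 3 l3).

Definition lift_coord k n (l : gT -> 'rV[F]_n) (v : 'rV[F]_n) : gT :=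
  odflt 1 [pick x in 'L_k(P) | l x == v].

Lemma lift_coordP k n (l : gT -> 'rV[F]_n) v : graded_coord P k l ->
  lift_coord k l v \in L k /\ l (lift_coord k l v) = v.
Proof.
case=> _ _ /(_ v)[x Lx lx]; rewrite /lift_coord; case: pickP => [y /andP[Ly /eqP] //|].
by move/(_ x); rewrite Lx lx eqxx.
Qed.

Lemma graded_coord_diff k n (l : gT -> 'rV[F]_n) x y : graded_coord P k.+1 l ->
  x \in L k.+1 -> y \in L k.+1 -> l x = l y -> exists2 g, g \in L k.+2 & x = y * g.
Proof.
case=> lH l0 _ Lx Ly lxy; exists (y^-1 * x); last by rewrite mulKVg.
by rewrite l0 ?groupM ?groupV // (gradedM lH) ?groupV // (gradedV lH) // lxy addNr.
Qed.

Lemma graded_comm_coordl (V : zmodType) i j n (l : gT -> 'rV[F]_n) (phi : gT -> V) x x' y :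
  graded_hom P (i + j).+2 phi -> graded_coord P i.+1 l ->
  x \in L i.+1 -> x' \in L i.+1 -> y \in L j.+1 -> l x = l x' -> phi [~ x, y] = phi [~ x', y].
Proof.
move=> phiH lP Lx Lx' Ly /(graded_coord_diff lP Lx Lx')[g Lg ->].
have Lg' := subsetP (lcn_subS _ _) _ Lg.
by rewrite (graded_commMl phiH erefl) // (graded_comm0l phiH erefl Lg Ly) addr0.
Qed.

Lemma graded_comm_coordr (V : zmodType) i j n (l : gT -> 'rV[F]_n) (phi : gT -> V) x y y' :
  graded_hom P (i + j).+2 phi -> graded_coord P j.+1 l ->
  x \in L i.+1 -> y \in L j.+1 -> y' \in L j.+1 -> l y = l y' -> phi [~ x, y] = phi [~ x, y'].
Proof.
move=> phiH lP Lx Ly Ly' /(graded_coord_diff lP Ly Ly')[g Lg ->].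
have Lg' := subsetP (lcn_subS _ _) _ Lg.
by rewrite (graded_commMr phiH erefl) // (graded_comm0r phiH erefl Lx Lg) addr0.
Qed.

(** Chosen lifts make this total. When the degree of [phi] is i + j, [bracketE] shows independence
    of the choice; [kap] takes [phi] one degree deeper, so it needs [kapE] instead. *)
Definition bracket (V : Type) i j n m (l : gT -> 'rV[F]_n) (l' : gT -> 'rV[F]_m)
    (phi : gT -> V) u v : V :=
  phi [~ lift_coord i l u, lift_coord j l' v].

Lemma bracketE (V : zmodType) i j n m (l : gT -> 'rV[F]_n) (l' : gT -> 'rV[F]_m) (phi : gT -> V) x y :
  graded_hom P (i + j).+2 phi -> graded_coord P i.+1 l -> graded_coord P j.+1 l' ->
  x \in L i.+1 -> y \in L j.+1 -> bracket i.+1 j.+1 l l' phi (l x) (l' y) = phi [~ x, y].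
Proof.
move=> phiH lP lP' Lx Ly.
have [Ls ls] := lift_coordP (l x) lP; have [Ls' ls'] := lift_coordP (l' y) lP'.
by rewrite /bracket (graded_comm_coordl phiH lP Ls Lx Ls' ls)
  (graded_comm_coordr phiH lP' Lx Ls' Ly ls').
Qed.

Lemma bracketA (V : zmodType) i j n m (l : gT -> 'rV[F]_n) (l' : gT -> 'rV[F]_m) (phi : gT -> V) :
  graded_hom P (i + j).+2 phi -> graded_coord P i.+1 l -> graded_coord P j.+1 l' ->
  additive2 (bracket i.+1 j.+1 l l' phi).
Proof.
move=> phiH lP lP'; have [lH _ lS] := lP; have [lH' _ lS'] := lP'.
split=> [v x y|u x y] /=.
  have [[[a La <-] [b Lb <-]] [c Lc <-]] := (lS x, lS y, lS' v).
  by rewrite -(gradedM lH) // !(bracketE phiH lP lP') ?groupM // (graded_commMl phiH erefl).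
have [[[a La <-] [b Lb <-]] [c Lc <-]] := (lS' x, lS' y, lS u).
by rewrite -(gradedM lH') // !(bracketE phiH lP lP') ?groupM // (graded_commMr phiH erefl).
Qed.

Definition br1 := bracket 1 1 l1 l1 l2.
Definition br2 := bracket 2 1 l2 l1 l3.
Definition kap := bracket 1 1 l1 l1 l3.

Let l1H : graded_hom P 1 l1. Proof. by case: l1P. Qed.
Let l2H : graded_hom P 2 l2. Proof. by case: l2P. Qed.
Let l3H : graded_hom P 3 l3. Proof. by case: l3P. Qed.
Let l1S v : exists2 x, x \in P & l1 x = v. Proof. by case: l1P => _ _ /(_ v). Qed.
Let l2S v : exists2 x, x \in L 2 & l2 x = v. Proof. by case: l2P. Qed.
Let l3S v : exists2 x, x \in L 3 & l3 x = v. Proof. by case: l3P. Qed.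

Lemma br1E x y : x \in P -> y \in P -> br1 (l1 x) (l1 y) = l2 [~ x, y].
Proof. exact: (@bracketE _ 0 0). Qed.

Lemma br2E w x : w \in L 2 -> x \in P -> br2 (l2 w) (l1 x) = l3 [~ w, x].
Proof. exact: (@bracketE _ 1 0). Qed.

Lemma graded_hom_dot f : graded_hom P 3 (fun x => dot (l3 x) f).
Proof.
split=> [x y Lx Ly|x Lx]; first by rewrite (gradedM l3H) // (additive2Dl (dotA _ _)).
by rewrite (graded0 l3H) // (additive2_0l (dotA _ _)).
Qed.

Lemma mem_L2_comm x y : x \in P -> y \in P -> [~ x, y] \in L 2.
Proof. by move=> Px Py; rewrite [L 2]lcnSn mem_commg. Qed.

Lemma mem_L3_comm x y : x \in P -> y \in P -> br1 (l1 x) (l1 y) = 0%R -> [~ x, y] \in L 3.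
Proof. by move=> Px Py; rewrite br1E //; case: l2P => _ H _; apply: H; apply: mem_L2_comm. Qed.

Lemma l1_eq0 x : x \in P -> (l1 x == 0%R) = (x \in P^`(1)).
Proof.
move=> Px; apply/eqP/idP; first by case: l1P => _ H _; apply: H.
exact: (graded0 l1H).
Qed.

Lemma br2_jacobi x y z :
  (br2 (br1 x y) z + br2 (br1 y z) x + br2 (br1 z x) y = 0)%R.
Proof.
have [[[a Pa <-] [b Pb <-]] [c Pc <-]] := (l1S x, l1S y, l1S z).
rewrite !br1E // !br2E ?mem_L2_comm //.
exact: (@graded_jacobi _ _ _ _ 0 0 0 _ _ _ l3H Pa Pb Pc).
Qed.

Section Kappa.

Variable f : 'rV[F]_n3.
Local Notation phi := (fun x => dot (l3 x) f).
Let phiH : graded_hom P 3 phi := graded_hom_dot f.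
Let CsP a : reflect (forall w, dot (br2 w a) f = 0%R) (a \in Cs br2 f).
Proof.
have br2A : additive2 br2 by apply: (@bracketA _ 1 0).
rewrite mem_subspace_of /=.
- by apply: (iffP forallP) => H w; [apply/eqP; apply: H | rewrite /= H].
- by apply/forallP => w; rewrite (additive2_0r br2A) (additive2_0l (dotA _ _)).
- move=> u v /forallP u0 /forallP v0; apply/forallP => w.
  by rewrite (additive2Dr br2A) (additive2Dl (dotA _ _)) (eqP (u0 w)) (eqP (v0 w)) addr0.
Qed.

Lemma phi_comm_Cs g y : g \in L 2 -> y \in P -> l1 y \in Cs br2 f -> phi [~ g, y] = 0%R.
Proof. by move=> Lg Py /CsP; rewrite -(br2E Lg Py); apply. Qed.

Lemma mem_L3_commM x g y : x \in P -> g \in L 2 -> y \in P -> [~ x, y] \in L 3 ->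
  [~ x * g, y] \in L 3.
Proof.
move=> Px Lg Py Lxy; rewrite commMgJ groupM //; last exact: mem_lcnS.
by rewrite memJ_norm // (subsetP (lcn_norm 3 P)) ?(lcn_mem_P Lg).
Qed.

Lemma phi_commMl x g y : x \in P -> g \in L 2 -> y \in P -> l1 y \in Cs br2 f ->
  [~ x, y] \in L 3 -> phi [~ x * g, y] = phi [~ x, y].
Proof.
move=> Px Lg Py Cy Lxy; have Pg := lcn_mem_P Lg.
rewrite commMgJ (gradedM phiH) ?(gradedJ phiH) //=.
- by rewrite [dot (l3 [~ g, y]) f](phi_comm_Cs Lg Py Cy) addr0.
- by rewrite memJ_norm // (subsetP (lcn_norm 3 P)).
- exact: mem_lcnS.
Qed.

Lemma phi_commMr x g y : x \in P -> g \in L 2 -> y \in P -> l1 x \in Cs br2 f ->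
  [~ x, y] \in L 3 -> phi [~ x, y * g] = phi [~ x, y].
Proof.
move=> Px Lg Py Cx Lxy; have Lyx : [~ y, x] \in L 3 by rewrite -invg_comm groupV.
rewrite (graded_comm_swap phiH (mem_L3_commM Py Lg Px Lyx)) phi_commMl //.
by rewrite -(graded_comm_swap phiH Lyx).
Qed.

(** Lifts differ by elements of L_2, whose commutators with lifts from [Cs f] are killed by [f]. *)
Lemma kapE x y : x \in P -> y \in P -> l1 x \in Cs br2 f -> l1 y \in Cs br2 f ->
  br1 (l1 x) (l1 y) = 0%R -> dot (kap (l1 x) (l1 y)) f = phi [~ x, y].
Proof.
move=> Px Py Cx Cy xy0; have Lxy := mem_L3_comm Px Py xy0.
have [Ls ls] := lift_coordP (l1 x) l1P; have [Lt lt] := lift_coordP (l1 y) l1P.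
have [g Lg Es] := graded_coord_diff l1P Ls Px ls.
have [h Lh Et] := graded_coord_diff l1P Lt Py lt.
rewrite /kap /bracket Es Et phi_commMr ?(groupM Px (lcn_mem_P Lg)) //.
- by rewrite phi_commMl.
- by rewrite -Es ls.
- exact: mem_L3_commM.
Qed.

Lemma kap_alternating (U : {vspace 'rV[F]_n1}) : (U <= Cs br2 f)%VS ->
  {in U &, forall x y, br1 x y = 0%R} -> alternating_on U (fun u v => dot (kap u v) f).
Proof.
move=> sUC U0; have Cs_U u : u \in U -> u \in Cs br2 f by apply: subvP.
have kN : {in U &, forall u v, dot (kap v u) f = - dot (kap u v) f}%R.
  move=> u v; have [[x Px <-] [y Py <-]] := (l1S u, l1S v) => Ux Uy.
  rewrite !kapE ?Cs_U ?U0 // (graded_comm_swap phiH) //.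
  by rewrite mem_L3_comm ?U0.
have kDl : {in U, forall v, {in U &, {morph (fun u => dot (kap u v) f) : x y / (x + y)%R}}}.
  move=> v Uv a b; have [[[x Px <-] [y Py <-]] [z Pz Ez]] := (l1S a, l1S b, l1S v).
  rewrite -Ez in Uv * => Ux Uy; rewrite -(gradedM l1H) //.
  have Uxy : l1 (x * y) \in U by rewrite (gradedM l1H) // memvD.
  rewrite !kapE ?groupM ?Cs_U ?U0 //.
  have [Lx Ly] : [~ x, z] \in L 3 /\ [~ y, z] \in L 3 by rewrite !mem_L3_comm ?U0.
  by rewrite commMgJ (gradedM phiH) ?(gradedJ phiH) // memJ_norm // (subsetP (lcn_norm 3 P)).
split=> // [u Uu a b Ua Ub|u].
  by rewrite (kN (a + b)%R) ?memvD // kDl // (kN u a) // (kN u b) // opprD !opprK.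
have [x Px <-] := l1S u => Ux.
by rewrite kapE ?Cs_U ?U0 // commgg (graded1 phiH).
Qed.

(** The Camina property solves [a, b] = z for a [z] in L_3 not killed by [f]; as [z] is in L_3,
    [br1] vanishes on the pair. *)
Lemma kap_onto x : f != 0%R -> x != 0%R -> x \in Cs br2 f ->
  exists2 y, br1 x y = 0%R & dot (kap x y) f != 0%R.
Proof.
move=> f0 x0 Cx; have [Ps Es] := lift_coordP x l1P; set a := lift_coord 1 l1 x in Ps Es.
have nP'a : a \notin P^`(1) by rewrite -l1_eq0 // Es.
have [v vf0] := dot_neq0 f0; have [z Lz Ez] := l3S v.
have Lz2 : z \in L 2 by apply: subsetP Lz; apply: lcn_subS.
have [b Pb ab] := camina_comm camP Ps nP'a Lz2.
exists (l1 b); first by rewrite -Es br1E // ab (graded0 l2H).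
have [Lt lt] := lift_coordP (l1 b) l1P.
have [h Lh Et] := graded_coord_diff l1P Lt Pb lt.
by rewrite /kap /bracket -/a Et phi_commMr ?Es // ab // Ez.
Qed.

End Kappa.

End CaminaLieInstance.

(** * Bounds on the nilpotency class *)

Section CaminaClass.

Variables (p : nat) (gT : finGroupType) (P : {group gT}).
Hypothesis p_pr : prime p.
Hypothesis camP : camina_pgroup p P.
Local Notation L n := 'L_n(P).
Local Notation F := 'F_p.

Section Instance.

Variables (n1 n2 n3 : nat).
Variables (l1 : gT -> 'rV[F]_n1) (l2 : gT -> 'rV[F]_n2) (l3 : gT -> 'rV[F]_n3).
Hypotheses (l1P : graded_coord P 1 l1) (l2P : graded_coord P 2 l2) (l3P : graded_coord P 3 l3).
Local Notation b1 := (br1 P l1 l2).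
Local Notation b2 := (br2 P l1 l2 l3).
Local Notation kp := (kap P l1 l3).

Lemma camina_lieP : camina_lie b1 b2 kp.
Proof.
have [l1H _ l1S] := l1P; have [l2H _ l2S] := l2P; have [l3H _ l3S] := l3P.
split=> //.
- exact: (@bracketA _ _ _ _ 0 0).
- exact: (@bracketA _ _ _ _ 1 0).
- by move=> x; have [a Pa <-] := l1S x; rewrite (br1E l1P l2P) // commgg (graded1 l2H).
- move=> x; have [a Pa <-] := l1S x; rewrite (l1_eq0 l1P) // => nP'a w.
  have [z Lz <-] := l2S w; have [b Pb ab] := camina_comm camP Pa nP'a Lz.
  by exists (l1 b); rewrite (br1E l1P l2P) // ab.
- move=> f f0; have phiH := graded_hom_dot l3P f.
  suff: [exists w, [exists a, dot (b2 w a) f != 0%R]].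
    by case/existsP=> w /existsP[a wa]; exists w, a.
  apply: contraT => /existsPn wa0; have [v] := dot_neq0 f0.
  have [z Lz <-] := l3S v; rewrite (graded_eq0 phiH) ?eqxx // => x y Lx Py.
  by have /existsPn/(_ (l1 y))/negPn/eqP := wa0 (l2 x); rewrite (br2E l1P l2P l3P).
- exact: br2_jacobi l1P l2P l3P.
- exact: kap_alternating l1P l2P l3P.
- exact: (kap_onto camP l1P l2P l3P).
Qed.

End Instance.

Theorem camina_odd_class3 : odd p -> L 4 = 1.
Proof.
move=> p_odd; apply/eqP/contraT => /(lcn_properS camP) /subsetPn[x Lx nLx].
have [n1 [l1 l1P]] := exists_graded_coord p_pr camP 0.
have [n2 [l2 l2P]] := exists_graded_coord p_pr camP 1.
have [n3 [l3 l3P]] := exists_graded_coord p_pr camP 2.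
have [n4 [l4 [l4H l40 _]]] := exists_graded_coord p_pr camP 3.
have [i li] : exists i, l4 x 0%R i != 0%R.
  apply/existsP; apply: contraNT nLx => /existsPn l4x; apply: l40 => //.
  by apply/rowP => i; rewrite mxE; apply/eqP; rewrite -[_ == _]negbK.
(* A coordinate that is nonzero on L_4 makes the pairings into L_4 scalar-valued. *)
pose tau g := l4 g 0%R i.
have tauH : graded_hom P 4 tau.
  split=> [g h Lg Lh|g Lg]; rewrite /tau; first by rewrite (gradedM l4H) // mxE.
  by rewrite (graded0 l4H) // mxE.
have [l1H _ l1S] := l1P; have [l2H _ l2S] := l2P; have [l3H _ l3S] := l3P.
pose br3 := bracket P 3 1 l3 l1 tau; pose br22 := bracket P 2 2 l2 l2 tau.
have br3E w a : w \in L 3 -> a \in P -> br3 (l3 w) (l1 a) = tau [~ w, a].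
  exact: (@bracketE _ _ _ _ 2 0).
have br22E w w' : w \in L 2 -> w' \in L 2 -> br22 (l2 w) (l2 w') = tau [~ w, w'].
  exact: (@bracketE _ _ _ _ 1 1).
apply: False_rect; apply: (@class_four_absurd p n1 n2 n3 _ _ _ br3 br22 (camina_lieP l1P l2P l3P)) => //.
- exact: (@bracketA _ _ _ _ 2 0).
- exact: (@bracketA _ _ _ _ 1 1).
- by move=> w; have [z Lz <-] := l2S w; rewrite br22E // commgg (graded1 tauH).
- suff: [exists l, [exists a, br3 l a != 0%R]].
    by case/existsP=> l /existsP[a la]; exists l, a.
  apply: contraT => /existsPn la0; case/eqP: li; apply: (graded_eq0 tauH) => // z y Lz Py.
  by have /existsPn/(_ (l1 y))/negPn/eqP := la0 (l3 z); rewrite br3E.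
move=> w a b; have [[[z Lz <-] [u Pu <-]] [v Pv <-]] := (l2S w, l1S a, l1S b).
rewrite !(br2E l1P l2P l3P) // (br1E l1P l2P) // !br3E ?mem_lcnS // br22E ?mem_L2_comm //.
have := @graded_jacobi _ _ _ tau 1 0 0 z u v tauH Lz Pu Pv.
have Luv := mem_L2_comm Pu Pv.
have -> : tau [~ [~ u, v], z] = (- tau [~ z, [~ u, v]])%R.
  by rewrite (graded_comm_swap tauH) // (@mem_lcn_comm _ P 1 1).
have -> : tau [~ [~ v, z], u] = (- tau [~ [~ z, v], u])%R.
  by rewrite -(invg_comm z v) (@graded_commVl _ _ _ _ _ tauH 2 0 erefl) // mem_lcnS.
by move=> /eqP; rewrite addrAC subr_eq0 => /eqP.
Qed.

End CaminaClass.

(** Squaring induces the map [s] on L_2: it is additive because [L_2, L_2] lies in L_4, and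
    independent of the lift because [phi (g ^+ 2)] is twice [phi g] for [g] in L_3. *)
Lemma camina_two_class2 (gT : finGroupType) (P : {group gT}) : camina_pgroup 2 P -> 'L_3(P) = 1.
Proof.
move=> camP; have p_pr : prime 2 by [].
apply/eqP/contraT => /(lcn_properS camP) /subsetPn[x0 Lx0 nLx0].
have [n1 [l1 l1P]] := exists_graded_coord p_pr camP 0.
have [n2 [l2 l2P]] := exists_graded_coord p_pr camP 1.
have [n3 [l3 l3P]] := exists_graded_coord p_pr camP 2.
have [l1H _ l1S] := l1P; have [l2H _ l2S] := l2P; have [l3H l30 l3S] := l3P.
pose f : 'rV['F_2]_n3 := l3 x0.
have f0 : f != 0%R by apply: contraNneq nLx0 => /(l30 x0 Lx0).
pose phi g := dot (l3 g) f; have phiH : graded_hom P 3 phi := graded_hom_dot l3P f.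
have N2 (u : 'F_2) : (- u = u)%R by rewrite oppr_pchar2 // pchar_Fp.
have sq (x : gT) : x ^+ 2 = x * x by rewrite expgS.
have sqL w : w \in 'L_2(P) -> w ^+ 2 \in 'L_3(P) by apply: (camina_expg p_pr camP).
have sqM : {in 'L_2(P) &, forall w w', phi ((w * w') ^+ 2) = (phi (w ^+ 2)%g + phi (w' ^+ 2)%g)%R}.
  move=> w w' Lw Lw'.
  have Lww : [~ w', w] \in 'L_4(P) by apply: (@mem_lcn_comm _ P 1 1).
  have Lc : [~ w', w] ^ w' \in 'L_4(P).
    by rewrite memJ_norm // (subsetP (lcn_norm 4 P)) ?(lcn_mem_P Lw').
  have -> : (w * w') ^+ 2 = w ^+ 2 * w' ^+ 2 * [~ w', w] ^ w'.
    by rewrite !sq conjgE /commg /conjg !mulgA ?mulgK ?mulgKV.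
  have Lc3 := subsetP (lcn_subS 3 P) _ Lc.
  rewrite (gradedM phiH (groupM (sqL _ Lw) (sqL _ Lw')) Lc3) (gradedM phiH) ?sqL //.
  by rewrite (graded0 phiH Lc) addr0.
pose s w := phi (lift_coord P 2 l2 w ^+ 2).
have sE w : w \in 'L_2(P) -> s (l2 w) = phi (w ^+ 2).
  move=> Lw; have [Ls ls] := lift_coordP (l2 w) l2P.
  have [g Lg Eg] := graded_coord_diff l2P Lw Ls (esym ls).
  rewrite /s [in RHS]Eg sqM ?(subsetP (lcn_subS 2 P) _ Lg) //.
  by rewrite (gradedX phiH 2 Lg) mulr2n -{1}(N2 (phi g)) addNr addr0.
have camL := camina_lieP p_pr camP l1P l2P l3P.
apply: False_rect; apply: (class_three_two_absurd camL f0 (s := s)).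
  move=> u v; have [[a La <-] [b Lb <-]] := (l2S u, l2S v).
  by rewrite -(gradedM l2H) // !sE ?groupM // sqM.
move=> c Cc a; move: Cc; have [[x Px <-] [y Py <-]] := (l1S c, l1S a) => Cx.
have Lxy := mem_L2_comm Px Py.
rewrite !(br1E l1P l2P) // (br2E l1P l2P l3P) // sE // -/(phi _).
have Ly2 : y ^+ 2 \in 'L_2(P) by apply: (@camina_expg _ _ _ p_pr camP 0).
(* Here [y ^+ 2] is in L_2 and [l1 x] in [Cs f]; expanding [x, y^2] = [x, y]^2 [[x, y], y] then
   gives the required value of [s]. *)
have E : phi [~ x, y ^+ 2] = 0%R.
  rewrite -(N2 0%R) -(phi_comm_Cs l1P l2P l3P Ly2 Px Cx) (graded_comm_swap phiH) //.
  exact: (@mem_lcn_comm _ P 1 0).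
move: E; have -> : [~ x, y ^+ 2] = [~ x, y] ^+ 2 * [~ [~ x, y], y].
  by rewrite !sq commgMJ conjg_mulR mulgA.
rewrite (gradedM phiH) ?sqL ?mem_lcnS // => /eqP.
by rewrite addr_eq0 N2 => /eqP.
Qed.

(** * Fixed points *)

(** Coprime action provides an A-invariant Sylow q-subgroup S of U. A minimal A-invariant subgroup M
    of the elements of order dividing q in Z(S) is an irreducible representation of A, and the
    centre of a group with a faithful irreducible representation is cyclic. *)
Lemma exists_min_normalized (p : nat) (gT : finGroupType) (A U : {group gT}) :
  p.-group A -> A \subset 'N(U) -> coprime #|U| p -> U :!=: 1 ->
  exists M : {group gT}, [/\ M \subset U, minnormal M A & cyclic 'Z(A / 'C_A(M))].
Proof.
move=> pA nUA co_Up ntU.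
have co_UA : coprime #|U| #|A|.
  have [->|ntA] := eqsVneq A 1; first by rewrite cards1 coprimen1.
  have [p_pr _ [n ->]] := pgroup_pdiv pA ntA.
  by rewrite coprimeXr.
have [q q_pr qU] : exists2 q, prime q & q %| #|U|.
  by exists (pdiv #|U|); rewrite ?pdiv_prime ?pdiv_dvd // cardG_gt1.
have [S sylS nSA] := sol_coprime_Sylow_exists q (pgroup_sol pA) nUA co_UA.
have ntS : S :!=: 1.
  rewrite -cardG_gt1 (card_Hall sylS) p_part -(exp1n (logn q #|U|)).
  by rewrite ltn_exp2r ?prime_gt1 // -pfactor_dvdn ?expn1.
have qS := pHall_pgroup sylS.
pose V := 'Ohm_1('Z(S))%G.
have ntZ : 'Z(S) != 1 by rewrite (center_nil_eq1 (pgroup_nil qS)).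
have qZ : q.-group 'Z(S) := pgroupS (center_sub S) qS.
have ntV : V :!=: 1.
  by rewrite Ohm1_eq1.
have abV : q.-abelem V by apply: Ohm1_abelem => //; apply: center_abelian.
have nVA : A \subset 'N(V).
  by rewrite (char_norm_trans (char_trans (Ohm_char 1 _) (center_char S))).
have [M minM sMV] : {M : {group gT} | minnormal M A & M \subset V}.
  by apply: (@mingroup_exists _ (fun M => ((M :!=: 1) && (A \subset 'N(M)))%g)); rewrite ntV.
exists M; split=> //.
  rewrite (subset_trans sMV) // (subset_trans (Ohm_sub 1 _)) //.
  by rewrite (subset_trans (center_sub S)) // (pHall_sub sylS).
have [/andP[ntM nMA] _] := mingroupP minM.
have abM := abelemS sMV abV.
have irrM : mx_irreducible (abelem_repr abM ntM nMA) by apply/abelem_mx_irrP.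
by have := center_kquo_cyclic irrM; rewrite rker_abelem.
Qed.

(** A cyclic group has at most one subgroup of order [p], so the image of [u] is a power of that of
    [v]. *)
Lemma cyclic_quotient_order_p (p : nat) (gT : finGroupType) (W C : {group gT}) u v :
  prime p -> cyclic (W / C) -> W \subset 'N(C) -> u \in W -> v \in W ->
  u ^+ p \in C -> v ^+ p \in C -> v \notin C -> exists k, u * (v ^+ k)^-1 \in C.
Proof.
move=> p_pr cycWC nCW Wu Wv Cup Cvp nCv.
have [Cu|nCu] := boolP (u \in C); first by exists 0; rewrite expg0 invg1 mulg1.
have nC x : x \in W -> x \in 'N(C) by apply: subsetP.
have ordp x : x \in W -> x \notin C -> x ^+ p \in C -> #[coset C x] = p.
  move=> Wx nCx Cxp; apply: nt_prime_order => //; first by rewrite -morphX ?nC //= coset_id.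
  by apply: contra nCx => /eqP/coset_idr; apply; apply: nC.
have eqUV : <[coset C u]> == <[coset C v]>.
  by rewrite (eq_subG_cyclic cycWC) ?cycle_subG ?mem_quotient // -!orderE !ordp.
have /cycleP[k Ek] : coset C u \in <[coset C v]> by rewrite -(eqP eqUV) cycle_id.
exists k; apply: coset_idr; first by rewrite nC ?groupM ?groupV ?groupX.
by rewrite morphM ?morphV ?morphX ?nC ?groupV ?groupX //= Ek mulgV.
Qed.

Section FixedPoints.

Variables (p : nat) (gT : finGroupType) (P Q : {group gT}).
Hypotheses (p_pr : prime p) (camP : camina_pgroup p P).
Hypotheses (nQP : P \subset 'N(Q)) (coQ : coprime #|Q| p).
Hypothesis cent_der : forall x, x \in Q^# -> 'C_P[x] \subset P^`(1).

Let pP : p.-group P := camP.1.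

Lemma cent_sub_der (M : {group gT}) : M \subset Q -> M :!=: 1 -> 'C_P(M) \subset P^`(1).
Proof.
move=> sMQ /trivgPn[x Mx x1]; apply: subset_trans (cent_der (_ : x \in Q^#)).
  by rewrite setIS // -cent_set1 centS // sub1set.
by rewrite !inE x1 (subsetP sMQ).
Qed.

(** The fixed points in [M] of a central element form an H-invariant subgroup, so minimality leaves
    only [M] itself. *)
Lemma central_fix_cent (H M : {group gT}) z m :
  minnormal M H -> z \in 'Z(H) -> m \in M -> m != 1 -> z \in 'C[m] -> z \in 'C(M).
Proof.
move=> /mingroupP[/andP[ntM nMH] minM] Zz Mm m1 cmz.
have nCH : H \subset 'N('C_M[z]).
  rewrite normsI // -cent_cycle norms_cent // cents_norm // centsC cycle_subG.
  by case/setIP: Zz.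
have <- : 'C_M[z] = M; last first.
  by rewrite -sub_cent1 subsetIr.
apply: minM; last exact: subsetIl.
rewrite nCH andbT; apply/trivgPn; exists m => //.
by rewrite inE Mm cent1C.
Qed.

(* If z moved M, the group generated by w and z would act on M without fixed points
   outside its kernel, hence as a cyclic group. *)
Lemma central_order_p_cent (H M : {group gT}) w z :
  H \subset P -> M \subset Q -> minnormal M H ->
  w \in H -> w \notin P^`(1) -> z \in 'Z(H) -> z \in P^`(1) ->
  w ^+ p \in 'C(M) -> z ^+ p \in 'C(M) -> z \in 'C(M).
Proof.
move=> sHP sMQ minM Hw nP'w Zz P'z cwp czp; apply: contraT => ncz.
have [/andP[ntM nMH] _] := mingroupP minM.
have [Hz cHz] := setIP Zz.
pose W := (<[w]> <*> <[z]>)%G.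
have sWH : W \subset H by rewrite join_subG !cycle_subG Hw Hz.
have Ww : w \in W by rewrite -cycle_subG joing_subl.
have Wz : z \in W by rewrite -cycle_subG joing_subr.
have abW : abelian W.
  rewrite abelianY !cycle_abelian cycle_subG.
  by apply/centP => _ /cycleP[i ->]; apply: commuteX; apply: (centP cHz).
have coM : coprime #|M| p := coprimeSg sMQ coQ.
have [M2 [sM2 minM2]] :=
  exists_min_normalized (pgroupS (subset_trans sWH sHP) pP) (subset_trans sWH nMH) coM ntM.
have [/andP[ntM2 nM2W] _] := mingroupP minM2.
set C := 'C_W(M2); have nCW : W \subset 'N(C) by rewrite normsI ?normG ?norms_cent.
have -> : 'Z(W / C) = W / C by apply/center_idP/quotient_abelian.
move=> cycWC.
have sCP' : C \subset P^`(1).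
  apply: subset_trans (cent_sub_der (subset_trans sM2 sMQ) ntM2).
  by rewrite setSI // (subset_trans sWH).
have sCM : 'C(M) \subset 'C(M2) by apply: centS.
have memC u : u \in W -> u ^+ p \in 'C(M) -> u ^+ p \in C.
  by move=> Wu cup; rewrite inE groupX ?(subsetP sCM).
have nCz : z \notin C.
  apply: contra ncz => /setIP[_ cM2z]; have [m M2m m1] := trivgPn _ ntM2.
  apply: (central_fix_cent minM Zz (subsetP sM2 m M2m) m1).
  by apply/cent1P; apply: (centP cM2z).
(* The product of [w] with a power of [z] acts trivially on [M2], so it lies in P'; since [z] does
   too, [w] would lie in P'. *)
have [k Cwz] := cyclic_quotient_order_p p_pr cycWC nCW Ww Wz (memC w Ww cwp) (memC z Wz czp) nCz.
case/negP: nP'w; rewrite -(mulgKV (z ^+ k) w) groupM ?groupX //.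
exact: subsetP sCP' _ Cwz.
Qed.

(** The previous lemma is applied to [z ^+ (p ^ n)] for decreasing [n], starting from the order of
    [z]. *)
Lemma central_cent (H M : {group gT}) w z :
  H \subset P -> M \subset Q -> minnormal M H ->
  w \in H -> w \notin P^`(1) -> w ^+ p \in 'C(M) ->
  z \in 'Z(H) -> z \in P^`(1) -> z \in 'C(M).
Proof.
move=> sHP sMQ minM Hw nP'w cwp Zz P'z.
have Pz : z \in P by apply: subsetP (der_sub 1 P) z P'z.
have [n On] := p_natP (mem_p_elt pP Pz).
have : z ^+ (p ^ n) \in 'C(M) by rewrite -On expg_order group1.
elim: n {On} => [|n IHn]; first by rewrite expn0 expg1.
rewrite expnSr expgM => cz; apply: IHn.
by apply: (central_order_p_cent sHP sMQ minM Hw nP'w _ _ cwp cz); apply: groupX.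
Qed.

(** If P' acted trivially, it would be the whole kernel on a minimal invariant subgroup; P / P',
    being its own centre, would be cyclic and P abelian. *)
Lemma der_not_cent (M : {group gT}) : M \subset Q -> M :!=: 1 -> P \subset 'N(M) ->
  ~~ (P^`(1) \subset 'C(M)).
Proof.
move=> sMQ ntM nMP; apply/negP => cMP'.
have coM : coprime #|M| p := coprimeSg sMQ coQ.
have [M2 [sM2 minM2]] := exists_min_normalized pP nMP coM ntM.
have [/andP[ntM2 _] _] := mingroupP minM2.
have -> : 'C_P(M2) = P^`(1).
  apply/eqP; rewrite eqEsubset cent_sub_der ?(subset_trans sM2) //= subsetI der_sub.
  exact: subset_trans cMP' (centS sM2).
have -> : 'Z(P / P^`(1)) = P / P^`(1) by apply/center_idP/der_abelian.
move/(cyclic_nilpotent_quo_der1_cyclic (pgroup_nil pP))/cyclic_abelian.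
by apply/negP; case: camP => _ [].
Qed.

(** For H generated by [x] and [y], the p-th powers of both are central in H. Cyclicity of Z(H / C)
    gives [w] outside P' with [w ^+ p] trivial on M. By [central_cent], [x, y] and these p-th powers
    act trivially; then H / C is abelian, so cyclic, contradicting independence of [x] and [y]
    modulo P'. *)
Lemma odd_pair_absurd x y : odd p -> Q :!=: 1 -> x \in P -> y \in P ->
  x \notin <[y]> <*> P^`(1) -> y \notin <[x]> <*> P^`(1) ->
  [~ x, y] \in 'Z(P) -> [~ x, y] ^+ p = 1 -> False.
Proof.
move=> p_odd ntQ Px Py nyx nxy Zc cp1.
pose H := (<[x]> <*> <[y]>)%G.
have sHP : H \subset P by rewrite join_subG !cycle_subG Px Py.
have Hx : x \in H by rewrite -cycle_subG joing_subl.
have Hy : y \in H by rewrite -cycle_subG joing_subr.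
have [M [sMQ minM]] := exists_min_normalized (pgroupS sHP pP) (subset_trans sHP nQP) coQ ntQ.
have [/andP[ntM nMH] _] := mingroupP minM.
set C := 'C_H(M) => cycZ.
have sCP' : C \subset P^`(1).
  by apply: subset_trans (cent_sub_der sMQ ntM); rewrite setSI.
have nCH : H \subset 'N(C) by rewrite normsI ?normG ?norms_cent.
set c := [~ x, y] in Zc cp1; have [Pc cPc] := setIP Zc.
have cc g : g \in P -> commute g c by move=> Pg; apply/esym/(centP cPc).
have ZHE g : g \in H -> commute g x -> commute g y -> g \in 'Z(H).
  move=> Hg cgx cgy; rewrite inE Hg /= -sub_cent1 join_subG !cycle_subG.
  by apply/andP; split; apply/cent1P.
have cxpy : commute (x ^+ p) y.
  by apply/commgP; rewrite commXg ?cp1 //; apply: cc.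
have cypx : commute (y ^+ p) x.
  by apply/commute_sym/commgP; rewrite commgX ?cp1 //; apply: cc.
have Zxp : x ^+ p \in 'Z(H) by apply: ZHE => //; [apply: groupX | apply/commute_sym/commuteX].
have Zyp : y ^+ p \in 'Z(H) by apply: ZHE => //; [apply: groupX | apply/commute_sym/commuteX].
have Hc : c \in H by rewrite groupR.
have ZHc : c \in 'Z(H) by apply: ZHE => //; apply/commute_sym/cc.
have P'c : c \in P^`(1) by rewrite mem_commg.
have [P'xp P'yp] : x ^+ p \in P^`(1) /\ y ^+ p \in P^`(1) by rewrite !(camina_expg_der camP).
(* The correction term is a power of [d] with exponent divisible by the binomial coefficient of [p]
   over 2, a multiple of [p] for odd [p]. *)
have expXY (u v : gT) k : u \in P -> v \in P -> [~ v, u] \in 'Z(P) -> [~ v, u] ^+ p = 1 ->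
    ((u ^+ k)^-1 * v) ^+ p = ((u ^+ p) ^+ k)^-1 * v ^+ p.
  move=> Pu Pv Zd dp1; set d := [~ v, u] in Zd dp1; have [_ cPd] := setIP Zd.
  have cd g : g \in P -> commute g d by move=> Pg; apply/esym/(centP cPd).
  have vuk : [~ v, (u ^+ k)^-1] = (d ^+ k)^-1.
    by rewrite commgV commgX //; try apply: commuteX; apply: cd; rewrite ?groupX.
  rewrite expMg_Rmul ?vuk; try by apply/commuteV/commuteX/cd; rewrite ?groupV ?groupX.
  have -> : (d ^+ k)^-1 ^+ 'C(p, 2) = 1.
    rewrite bin2odd // expgM expgVn -(expgM d) [(k * p)%N]mulnC (expgM d) dp1.
    by rewrite expg1n invg1 expg1n.
  by rewrite mulg1 expgVn -(expgM u) [(k * p)%N]mulnC (expgM u).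
have [w [Hw nP'w cwp]] : exists w, [/\ w \in H, w \notin P^`(1) & w ^+ p \in 'C(M)].
  have chain u v : u \in H -> v \in H -> u ^+ p \in 'Z(H) -> v ^+ p \in 'Z(H) ->
      u \notin <[v]> <*> P^`(1) -> [~ u, v] \in 'Z(P) -> [~ u, v] ^+ p = 1 ->
      <[coset C (u ^+ p)]> \subset <[coset C (v ^+ p)]> ->
      exists w, [/\ w \in H, w \notin P^`(1) & w ^+ p \in 'C(M)].
    move=> Hu Hv Zu Zv nuv Zd dp1; rewrite cycle_subG => /cycleP[k Ek].
    have nC g : g \in H -> g \in 'N(C) by apply: subsetP.
    exists ((v ^+ k)^-1 * u); split; first by rewrite groupM ?groupV ?groupX.
      apply: contra nuv => P'w; rewrite -(mulKVg (v ^+ k) u) groupM //.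
        by rewrite groupX // mem_gen // inE cycle_id.
      by rewrite mem_gen // inE P'w orbT.
    rewrite expXY ?(subsetP sHP) //; apply: (subsetP (subsetIr H _)).
    rewrite -[_ :&: _]/C; apply: coset_idr; first by rewrite nC ?groupM ?groupV ?groupX.
    by rewrite morphM ?morphV ?(morphX _ k) ?nC ?groupV ?groupX //= Ek mulVg.
  have memZ g : g \in 'Z(H) -> coset C g \in 'Z(H / C).
    case/setIP=> Hg cHg; rewrite inE mem_quotient //= (subsetP (quotient_cents C (subsetIr H 'C(H)))) //.
    by rewrite mem_quotient // inE Hg.
  have pHC g : g \in H -> p.-elt (coset C g).
    move=> Hg; apply: (mem_p_elt (quotient_pgroup C (pgroupS sHP pP))).
    exact: mem_quotient.
  (* Both orders are powers of [p], so in the cyclic centre one of the two subgroups contains the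
     other. *)
  have [[m Em] [n En]] := (p_natP (pHC _ (groupX p Hx)), p_natP (pHC _ (groupX p Hy))).
  have [le_mn|le_nm] := leqP m n.
    apply: (chain x y) => //; rewrite -(cardSg_cyclic cycZ) ?cycle_subG ?memZ //.
    by rewrite -!orderE Em En dvdn_exp2l.
  apply: (chain y x) => //; first by rewrite -invg_comm groupV.
    by rewrite -invg_comm expgVn cp1 invg1.
  rewrite -(cardSg_cyclic cycZ) ?cycle_subG ?memZ //.
  by rewrite -!orderE Em En dvdn_exp2l // ltnW.
have cM z : z \in 'Z(H) -> z \in P^`(1) -> z \in 'C(M).
  exact: central_cent sHP sMQ minM Hw nP'w cwp.
have cycH : cyclic (H / C).
  suff /center_idP <- : abelian (H / C) by [].
  rewrite sub_der1_abelian // subsetI der_sub /= -[H^`(1)]/(_^`(1)) der1_joing_cycles //.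
    by rewrite cycle_subG cM.
  by case/setIP: ZHc.
have inC z : z \in 'Z(H) -> z \in P^`(1) -> z \in C.
  by move=> Zz P'z; rewrite inE cM // andbT; case/setIP: Zz.
have nCx : x \notin C by apply: contra nyx => Cx; rewrite mem_gen // inE (subsetP sCP') ?orbT.
have [k Ck] := cyclic_quotient_order_p p_pr cycH nCH Hy Hx (inC _ Zyp P'yp) (inC _ Zxp P'xp) nCx.
case/negP: nxy; rewrite -(mulgKV (x ^+ k) y) groupM //.
  by rewrite mem_gen // inE (subsetP sCP') ?orbT.
by rewrite groupX // mem_gen // inE cycle_id.
Qed.

End FixedPoints.

(** * Pairs independent modulo the derived subgroup *)

Section CaminaPair.

Variables (p : nat) (gT : finGroupType) (P : {group gT}).
Hypotheses (p_pr : prime p) (camP : camina_pgroup p P).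

Lemma mem_cycle_der x y : x \in P -> y \in <[x]> <*> P^`(1) ->
  exists k, exists2 g, g \in P^`(1) & y = x ^+ k * g.
Proof.
move=> Px; rewrite norm_joinEl; last by rewrite cycle_subG (subsetP (der_norm 1 P)).
by case/mulsgP=> _ g /cycleP[k ->] P'g ->; exists k; exists g.
Qed.

Lemma cycle_der_sym x y : x \in P -> y \in P -> x \notin P^`(1) ->
  y \notin <[x]> <*> P^`(1) -> x \notin <[y]> <*> P^`(1).
Proof.
move=> Px Py nP'x; apply: contra => yx.
pose W := (<[y]> <*> P^`(1))%G.
have nW : W \subset 'N(P^`(1)).
  by rewrite join_subG cycle_subG normG (subsetP (der_norm 1 P)).
have cycW : cyclic (W / P^`(1)).
  by rewrite quotientYidr ?quotient_cycle ?cycle_cyclic // ?cycle_subG (subsetP (der_norm 1 P)).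
have Wy : y \in W by rewrite -cycle_subG joing_subl.
have [P'yp P'xp] := (camina_expg_der camP Py, camina_expg_der camP Px).
have [k Hk] := cyclic_quotient_order_p p_pr cycW nW Wy yx P'yp P'xp nP'x.
rewrite -(mulgKV (x ^+ k) y) groupM //; first by rewrite mem_gen // inE Hk orbT.
by rewrite groupX // mem_gen // inE cycle_id.
Qed.

Lemma der1_proper_cycle x : x \in P -> ~~ (P \subset <[x]> <*> P^`(1)).
Proof.
move=> Px; apply/negP => sPx; case: camP => pP [/negP nabP _]; apply: nabP.
apply: cyclic_abelian; apply: (cyclic_nilpotent_quo_der1_cyclic (pgroup_nil pP)).
have nx : <[x]> \subset 'N(P^`(1)) by rewrite cycle_subG (subsetP (der_norm 1 P)).
apply: (cyclicS (quotientS _ sPx)); rewrite /= quotientYidr // quotient_cycle ?cycle_cyclic //.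
by rewrite -cycle_subG.
Qed.

Lemma der1_proper : exists2 x, x \in P & x \notin P^`(1).
Proof.
have /subsetPn[x Px nx] := der1_proper_cycle (group1 P); exists x => //.
by apply: contra nx => P'x; rewrite mem_gen // inE P'x orbT.
Qed.

Lemma lcn_center k : 'L_k.+2(P) = 1 -> 'L_k.+1(P) \subset 'Z(P).
Proof. by move=> L1; rewrite subsetI lcn_sub /=; apply/commG1P; rewrite -lcnSn. Qed.

(** In class 2 any independent pair works. In class 3 the pair lifts [u] in C_f and a [v] with
    [u, v] in L_3 not killed by [f]; dependence modulo P' would put the commutator in [P', x], which
    [f] kills. *)
Lemma camina_odd_pair : odd p -> exists x y,
  [/\ x \in P, y \in P, x \notin <[y]> <*> P^`(1) & y \notin <[x]> <*> P^`(1)] /\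
  [~ x, y] \in 'Z(P) /\ [~ x, y] ^+ p = 1.
Proof.
move=> p_odd; have L4 := camina_odd_class3 p_pr camP p_odd.
have [L3|] := eqVneq ('L_3(P)) 1.
  have [x Px nP'x] := der1_proper; have /subsetPn[y Py nxy] := der1_proper_cycle Px.
  exists x, y; split; first by split=> //; apply: cycle_der_sym.
  have L2xy := mem_L2_comm Px Py; split; first exact: (subsetP (lcn_center L3)).
  by apply/set1P; rewrite -[[set 1]]L3; apply: (camina_expg p_pr camP).
move/(lcn_properS camP) => /subsetPn[x0 Lx0 nLx0].
have [n1 [l1 l1P]] := exists_graded_coord p_pr camP 0.
have [n2 [l2 l2P]] := exists_graded_coord p_pr camP 1.
have [n3 [l3 l3P]] := exists_graded_coord p_pr camP 2.
have [l3H l30 l3S] := l3P.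
pose f : 'rV['F_p]_n3 := l3 x0.
have f0 : f != 0%R by apply: contraNneq nLx0 => /(l30 x0 Lx0).
have camL := camina_lieP p_pr camP l1P l2P l3P.
have n3_gt0 : 0 < n3 by rewrite lt0n; apply: contra f0 => /eqP/(row_dim0 f) ->.
set C := Cs (br2 P l1 l2 l3) f; pose u := vpick C.
have Cu : u \in C by apply: memv_pick.
have u0 : u != 0%R.
  rewrite vpick0 -dimv_eq0 (dim_Cs camL n3_gt0 f0).1.
  by have := dim_L3 camL n3_gt0; case: (n2); rewrite // muln0.
have [v uv0 kuv] := camina_kap_onto camL f0 u0 Cu.
have [Px Ex] := lift_coordP u l1P; have [Py Ey] := lift_coordP v l1P.
set x := lift_coord P 1 l1 u in Px Ex; set y := lift_coord P 1 l1 v in Py Ey.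
have L3xy : [~ x, y] \in 'L_3(P) by apply: (mem_L3_comm l1P l2P) => //; rewrite Ex Ey.
have nP'x : x \notin P^`(1) by rewrite -(l1_eq0 l1P) // Ex.
have nxy : y \notin <[x]> <*> P^`(1).
  apply: contraNN kuv => /(mem_cycle_der Px)[k [g P'g Eg]].
  rewrite /kap /bracket -/x -/y Eg commgMJ.
  have -> : [~ x, x ^+ k] = 1 by apply/eqP/commgP/commuteX.
  rewrite conj1g mulg1.
  have phiH := graded_hom_dot l3P f.
  have Lgx : [~ g, x] \in 'L_3(P) by rewrite (@mem_lcnS _ P 1).
  have := graded_comm_swap phiH Lgx => /= ->.
  by rewrite (phi_comm_Cs l1P l2P l3P P'g Px) ?Ex // GRing.oppr0.
exists x, y; split; first by split=> //; apply: cycle_der_sym.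
split; first exact: (subsetP (lcn_center L4)).
by apply/set1P; rewrite -[[set 1]]L4; apply: (camina_expg p_pr camP).
Qed.

End CaminaPair.

(** The relations make [P] an image of the quaternion group, and a nonabelian 2-group has order at
    least 8. *)
Lemma quaternion8_isog (gT : finGroupType) (P : {group gT}) x y :
  2.-group P -> ~~ abelian P -> P :=: <[x]> <*> <[y]> ->
  x ^+ 4 = 1 -> y ^+ 2 = x ^+ 2 -> x ^ y = x^-1 -> P \isog 'Q_8.
Proof.
move=> pP nabP defP x4 y2 xy.
have hom : P \homg 'Q_(2 ^ 3).
  rewrite Grp_quaternion //; apply/existsP; exists (x, y).
  by rewrite /= !xpair_eqE xy x4 y2 defP joing_idl joing_idr !eqxx.
rewrite isogEcard hom (@card_quaternion 3) //.
have [n oP] := p_natP pP; rewrite oP leq_exp2l // ltnNge.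
by apply: contra nabP => n2; apply: (p2group_abelian pP); rewrite oP pfactorK.
Qed.

(** * The case p = 2 *)

Section TwoGroup.

Variables (gT : finGroupType) (P Q : {group gT}).
Hypotheses (camP : camina_pgroup 2 P).
Hypotheses (nQP : P \subset 'N(Q)) (coQ : coprime #|Q| 2) (ntQ : Q :!=: 1).
Hypothesis cent_der : forall x, x \in Q^# -> 'C_P[x] \subset P^`(1).

Let pr2 : prime 2 := isT.
Let pP : 2.-group P := camP.1.
Let L3 := camina_two_class2 camP.

(** Let C be the kernel on a minimal M. No square of an element outside P' lies in C, by
    [central_order_p_cent] and [der_not_cent]. This leaves at most four cosets of P' and makes P' =
    {1, c} with c = [x, y], so every element outside P' has square c. *)
Lemma two_isog_quaternion : P \isog 'Q_8 /\ #|P^`(1)| <= 2.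
Proof.
have sZ : P^`(1) \subset 'Z(P) := lcn_center L3.
have sq1 z : z \in P^`(1) -> z ^+ 2 = 1.
  by move=> P'z; apply/set1P; rewrite -[[set 1]]L3; apply: (@camina_expg _ _ _ pr2 camP 1).
have [M [sMQ minM]] := exists_min_normalized pP nQP coQ ntQ.
have [/andP[ntM nMP] _] := mingroupP minM; set C := 'C_P(M) => cycZ.
have sCP' : C \subset P^`(1) := cent_sub_der cent_der sMQ ntM.
have nCP : P \subset 'N(C) by rewrite normsI ?normG ?norms_cent.
have [z P'z ncz] := subsetPn (der_not_cent camP coQ cent_der sMQ ntM nMP).
have memC w : w \in P^`(1) -> (w \in C) = (w \in 'C(M)).
  by move=> P'w; rewrite inE (subsetP (der_sub 1 P)).
have sqC w : w \in P -> w \notin P^`(1) -> w ^+ 2 \notin C.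
  move=> Pw nP'w; rewrite memC ?(camina_expg_der camP) //.
  apply: contra ncz => cw2.
  apply: (central_order_p_cent pr2 camP coQ cent_der (subxx P) sMQ minM Pw nP'w) => //.
    exact: (subsetP sZ).
  by rewrite sq1.
(* P' has exponent dividing 2 and its image modulo C lies in the cyclic centre, so this image has
   order at most 2. *)
have divC u v : u \in P^`(1) -> v \in P^`(1) -> u \notin C -> v \notin C -> u * v \in C.
  move=> P'u P'v nCu nCv.
  have cycW : cyclic (P^`(1) / C).
    apply: cyclicS cycZ; rewrite subsetI quotientS ?der_sub //=.
    by apply: quotient_cents; case/subsetIP: sZ.
  have sqC' w : w \in P^`(1) -> w ^+ 2 \in C by move=> P'w; rewrite sq1.
  have nCP' := subset_trans (der_sub 1 P) nCP.
  have [k] := cyclic_quotient_order_p pr2 cycW nCP' P'u P'v (sqC' u P'u) (sqC' v P'v) nCv.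
  have v2k j : v ^+ j.*2 = 1 by rewrite -mul2n expgM sq1 // expg1n.
  rewrite -(odd_double_half k) expgD v2k mulg1.
  case: (odd k); last by rewrite expg0 invg1 mulg1 (negbTE nCu).
  suff -> : (v ^+ true)^-1 = v by [].
  by apply: (mulgI v); rewrite mulgV -(sq1 v P'v) expgS.
have cP' g h : g \in P^`(1) -> h \in P -> commute g h.
  by move=> P'g Ph; have /setIP[_ /centP/(_ h Ph)] := subsetP sZ g P'g.
(* Otherwise (yx)^2 = y^2 x^2 [x, y] would be in C, since by [divC] the product of the two squares
   is. *)
have commC x y : x \in P -> y \in P -> x \notin P^`(1) -> y \notin P^`(1) ->
    [~ x, y] \in C -> y * x \in P^`(1).
  move=> Px Py nx ny Cxy; apply: contraT => nyx.
  have P'xy : [~ x, y] \in P^`(1) by rewrite mem_commg.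
  have /negP[] := sqC (y * x) (groupM Py Px) nyx.
  rewrite expMg_Rmul; try by apply/commute_sym/cP'.
  by rewrite binn expg1 groupM // divC ?sqC ?(camina_expg_der camP).
have [x Px nP'x] := der1_proper camP.
have /subsetPn[y Py nxy] := der1_proper_cycle camP Px.
have nP'y : y \notin P^`(1) by apply: contra nxy => P'y; rewrite mem_gen // inE P'y orbT.
set c := [~ x, y].
have P'c : c \in P^`(1) by rewrite mem_commg.
have nCc : c \notin C.
  apply: contra nxy => /(commC x y Px Py nP'x nP'y) P'yx.
  by rewrite -(mulgK x y) groupM ?groupV ?[x \in _]mem_gen ?inE ?cycle_id // mem_gen // inE P'yx orbT.
(* Outside P' and xP', [x, w] is not in C, so [x, yw] = [x, w] c is; [commC] then places [w] in yP'
   or xyP'. *)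
have P_cases w : w \in P -> exists2 g, g \in P^`(1) & [\/ w = g, w = x * g, w = y * g | w = x * y * g].
  move=> Pw; pose f := coset P^`(1).
  have nP u : u \in P -> u \in 'N(P^`(1)) by apply: subsetP; apply: der_norm.
  have fM u v : u \in P -> v \in P -> f (u * v) = f u * f v by move=> Pu Pv; rewrite /f morphM ?nP.
  have fC u v : u \in P -> v \in P -> f u * f v = f v * f u.
    move=> Pu Pv; apply: (centsP (der_abelian 0 P)); exact: mem_quotient.
  have fK u : u \in P -> f u * f u = 1.
    by move=> Pu; rewrite -fM // -(expgS u 1) /f coset_id // (camina_expg_der camP).
  have fP u : u \in P -> f u = 1 -> u \in P^`(1) by move=> Pu /coset_idr; apply; apply: nP.
  have P'f u : u \in P^`(1) -> f u = 1 by apply: coset_id.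
  have fV u : u \in P -> f u^-1 = f u.
    by move=> Pu; apply: (mulgI (f u)); rewrite -fM ?groupV // mulgV fK // P'f.
  have [P'w|nP'w] := boolP (w \in P^`(1)); first by exists w; [|constructor 1].
  have [P'xw|nP'xw] := boolP (x^-1 * w \in P^`(1)).
    by exists (x^-1 * w); rewrite ?mulKVg //; constructor 2.
  have nCxw : [~ x, w] \notin C.
    apply: contra nP'xw => /(commC x w Px Pw nP'x nP'w)/P'f; rewrite fM // => fwx.
    by apply: fP; rewrite ?groupM ?groupV // fM ?groupV // fV // fC.
  have Cxyw : [~ x, y * w] \in C.
    have -> : [~ x, y * w] = [~ x, w] * c.
      by rewrite commgMJ -/c; congr (_ * _); apply/conjg_fixP/commgP/cP'.
    by rewrite divC // mem_commg.
  have [P'yw|nP'yw] := boolP (y^-1 * w \in P^`(1)).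
    by exists (y^-1 * w); rewrite ?mulKVg //; constructor 3.
  have nP'yw' : y * w \notin P^`(1).
    apply: contra nP'yw => /P'f; rewrite fM // => fyw.
    by apply: fP; rewrite ?groupM ?groupV // fM ?groupV // fV.
  have /P'f := commC x (y * w) Px (groupM Py Pw) nP'x nP'yw' Cxyw.
  rewrite !fM ?groupM // => fywx.
  exists ((x * y)^-1 * w); last by rewrite mulKVg; constructor 4.
  apply: fP; rewrite ?groupM ?groupV ?groupM // fM ?groupV ?groupM // fV ?groupM // fM //.
  by rewrite -mulgA -(fM y w) // fC ?groupM // fM.
(* By the Camina property each element of P' is [x, v], which depends only on the coset of [v]
   modulo the central subgroup P'. *)
have P'E w : w \in P^`(1) -> w = 1 \/ w = c.
  move=> P'w; have [v Pv <-] := camina_comm camP Px nP'x P'w.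
  have commMg u g : u \in P -> g \in P^`(1) -> [~ x, u * g] = [~ x, u].
    move=> Pu P'g; rewrite commgMJ.
    have -> : [~ x, g] = 1 by apply/eqP/commgP/commute_sym/cP'.
    rewrite mul1g; apply/conjg_fixP/commgP/commute_sym/cP' => //.
    by rewrite groupR.
  have [g P'g] := P_cases v Pv; case=> ->.
  - by left; rewrite -[g]mul1g commMg // commg1.
  - by left; rewrite commMg // commgg.
  - by right; rewrite commMg.
  - by right; rewrite commMg ?groupM // commgMJ commgg conj1g mulg1.
have c1 : c != 1 by apply: contraNneq nCc => ->; apply: group1.
have sqc w : w \in P -> w \notin P^`(1) -> w ^+ 2 = c.
  move=> Pw nw; have := sqC w Pw nw.
  by case: (P'E _ (camina_expg_der camP Pw)) => -> //; rewrite group1.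
split; last first.
  have /subset_leq_card/leq_trans : P^`(1) \subset [set 1; c].
    by apply/subsetP => w /P'E; rewrite !inE; case=> ->; rewrite eqxx ?orbT.
  by apply; rewrite cards2; case: (1 != c).
apply: (@quaternion8_isog _ P x y) => //.
- by case: camP => _ [].
- apply/eqP; rewrite eqEsubset; apply/andP; split; last by rewrite join_subG !cycle_subG Px Py.
  have Wx : x \in <[x]> <*> <[y]> by rewrite mem_gen // inE cycle_id.
  have Wy : y \in <[x]> <*> <[y]> by rewrite mem_gen // inE cycle_id orbT.
  have Wc : c \in <[x]> <*> <[y]> by rewrite groupR.
  apply/subsetP => w /P_cases[g /P'E Eg]; have {Eg}Wg : g \in <[x]> <*> <[y]>.
    by case: Eg => ->; rewrite ?group1.
  by case=> ->; rewrite ?groupM.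
- by rewrite (expgM x 2 2) (sqc x) // sq1.
- by rewrite !sqc.
- rewrite conjg_mulR -/c -(sqc x) //; apply: (mulgI x); rewrite mulgV mulgA.
  by rewrite -(expgS x 1) (sqc x) // -(expgS c 1) sq1.
Qed.

End TwoGroup.

(** * From conjugation to arbitrary actions *)

Lemma camina_fpf_isog (p : nat) (gT : finGroupType) (P Q : {group gT}) :
  prime p -> camina_pgroup p P -> P \subset 'N(Q) -> coprime #|Q| p -> Q :!=: 1 ->
  (forall x, x \in Q^# -> 'C_P[x] \subset P^`(1)) ->
  (forall x, x \in Q^# -> 'C_P[x] = 1) /\ P \isog 'Q_8.
Proof.
move=> p_pr camP nQP coQ ntQ cent_der.
have p2 : p = 2.
  have [//|p_odd] := even_prime p_pr.
  have [x [y [[Px Py nyx nxy] [Zc cp1]]]] := camina_odd_pair p_pr camP p_odd.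
  by case: (odd_pair_absurd p_pr camP nQP coQ cent_der p_odd ntQ Px Py nyx nxy Zc cp1).
subst p; have [isoQ oP'] := two_isog_quaternion camP nQP coQ ntQ cent_der.
split=> // x Qx; apply/eqP/contraT => ntC.
have eC : 'C_P[x] = P^`(1).
  by apply/eqP; rewrite eqEcard cent_der // (leq_trans oP') // cardG_gt1.
have ntU : 'C_Q(P^`(1)) != 1.
  apply/trivgPn; case/setD1P: Qx => x1 Qx; exists x; rewrite // inE Qx /=.
  by rewrite -sub_cent1 -eC subsetIr.
have nU : P \subset 'N('C_Q(P^`(1))) by rewrite normsI ?norms_cent ?der_norm.
case/negP: (der_not_cent camP coQ cent_der (subsetIl Q _ : 'C_Q(P^`(1))%G \subset Q) ntU nU).
by rewrite centsC subsetIr.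
Qed.

Lemma camina_pgroup_injm (p : nat) (aT rT : finGroupType) (P : {group aT}) (f : {morphism P >-> rT}) :
  'injm f -> camina_pgroup p P -> camina_pgroup p (f @* P).
Proof.
move=> injf [pP [nabP clP]]; split; first by rewrite morphim_pgroup.
split; first by rewrite (injm_abelian injf).
move=> _ /setDP[/morphimP[x _ Px ->]]; rewrite -morphim_der // => nP'fx.
have nP'x : x \notin P^`(1) by apply: contra nP'fx => P'x; apply: mem_morphim.
by rewrite -morphim_class // clP ?inE ?nP'x ?Px // morphimMl ?sub1set // morphim_set1.
Qed.

Theorem theorem2 (p : nat) (aT rT : finGroupType)
    (P : {group aT}) (Q : {group rT}) (to : groupAction P Q) :
  prime p ->
  camina_pgroup p P ->
  Q :!=: 1 ->
  coprime #|Q| p ->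
  (forall x, x \in Q^# -> 'C_P[x | to] \subset P^`(1)) ->
  (forall x, x \in Q^# -> 'C_P[x | to] = 1) /\ P \isog 'Q_8.
Proof.
move=> p_pr camP ntQ coQ cent_der.
(* In the semidirect product the action becomes conjugation, and stabilizers become centralizers. *)
pose f1 := sdpair1 to; pose f2 := sdpair2 to.
have [inj1 inj2] := (injm_sdpair1 to, injm_sdpair2 to).
have centE x : x \in Q -> 'C_(f2 @* P)[f1 x] = f2 @* 'C_P[x | to].
  move=> Qx; rewrite astabEsd ?sub1set // morphim_setIpre.
  by rewrite morphim_set1 // cent_set1.
have ntQ1 : f1 @* Q != 1 by rewrite morphim_injm_eq1.
have coQ1 : coprime #|f1 @* Q| p by rewrite card_injm.
have cent1 y : y \in (f1 @* Q)^# -> 'C_(f2 @* P)[y] \subset (f2 @* P)^`(1).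
  case/setD1P=> y1 /morphimP[x _ Qx Ey]; rewrite Ey centE // -morphim_der // morphimS //.
  by rewrite cent_der // !inE Qx andbT; apply: contraNneq y1 => x1; rewrite Ey x1 morph1.
have [frob isoQ] := camina_fpf_isog p_pr (camina_pgroup_injm inj2 camP)
  (im_sdpair_norm to) coQ1 ntQ1 cent1.
split=> [x /setD1P[x1 Qx]|]; last exact: isog_trans (sub_isog _ inj2) isoQ.
have fx : f1 x \in (f1 @* Q)^#.
  by rewrite !inE mem_morphim // andbT morph_injm_eq1.
apply/eqP; rewrite -(morphim_injm_eq1 inj2) ?subsetIl //.
by rewrite -centE // frob.
Qed.
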